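(* Fix a deterministic horizon $T\ge 1$ and consider the FedHV process described in the context, with all the assumptions listed there (uniform client averaging, smoothness and stochastic gradients, trajectory-wise heterogeneity, safe reference on the horizon, stepsizes, objective-report sampling), and with participation rate $p=M/N\in(0,1]$. Put $\eta_{\mathrm{eff}}:=\eta_g\eta_\ell K$, $\Phi_{\mathrm{lb}}:=-\sum_{i=1}^m\log r_i$, $\Sigma^2:=\sum_i\sigma_i^2$, $\zeta^2:=\sum_i\zeta_i^2$, $Q:=\zeta^2+\Sigma^2$, $G_i^2:=2L_ir_i$, $G_{\max}:=\max_iG_i$, $\bar G^2:=2(G_{\max}^2+4Q)$, $$\chi_N(M):=\frac{N-M}{M(N-1)},\qquad \mathcal H_N(p;\zeta):=\chi_N(M)\sum_{i=1}^m\zeta_i^2,\qquad \Xi_{\mathrm{loss},T}:=\max_{0\le t<T}\mathbb E\big[\|\widehat{\mathbf F}^{\,t}-\mathbf F(\theta^t)\|_\infty^2\big],$$ $$\mathcal V:=6G_{\max}^2+3\frac{\Sigma^2}{K}+6\mathcal H_N(p;\zeta)+\frac{L_w^2\bar G^2}{2}\eta_\ell^2(K-1)(2K-1).$$ Then $$\frac1T\sum_{t=0}^{T-1}\mathbb E\|\nabla\Phi(\theta^t)\|^2\le \frac{A_1(\Phi(\theta^0)-\Phi_{\mathrm{lb}})}{\eta_{\mathrm{eff}}T}+A_2\eta_{\mathrm{eff}}\Sigma^2+A_3\eta_{\mathrm{eff}}\mathcal H_N(p;\zeta)+A_4\eta_\ell^2(K-1)(2K-1)+A_5\Xi_{\mathrm{loss},T}+A_6\eta_{\mathrm{eff}}^2\mathcal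 V+\frac{A_7}{T},$$ where, with $\bar\eta_{\mathrm{eff}}:=\frac{c_{\min}^2}{48\,c_{\max}L_\Phi}$, $E_{\mathrm{wt}}:=c_{\max}+6L_\Phi\bar\eta_{\mathrm{eff}}$ and $C:=2/\rho_{\mathrm{clip}}$, one may take $$A_1=4c_{\max},\quad A_2=6c_{\max}L_\Phi,\quad A_3=12c_{\max}L_\Phi,\quad A_4=c_{\max}L_w^2\bar G^2(c_{\max}+L_\Phi\bar\eta_{\mathrm{eff}}),$$ $$A_5=8c_{\max}E_{\mathrm{wt}}G_{\max}^2C^2,\quad A_6=8c_{\max}E_{\mathrm{wt}}G_{\max}^4C^2,\quad A_7=16c_{\max}E_{\mathrm{wt}}G_{\max}^2 .$$ Consequently $\min_{0\le t<T}\mathbb E\|\nabla\Phi(\theta^t)\|^2$ is bounded by the same right-hand side.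
   Context: **Objectives.** There are $N\ge2$ clients and $m\ge1$ tasks. Client $k$ holds $n_k=n/N$ examples $x_{k,1},\dots,x_{k,n_k}$ (all $n_k$ equal). For $\theta\in\mathbb R^d$, $f_i^{(k)}(\theta)=\frac1{n_k}\sum_j\ell_i(\theta;x_{k,j})$ (each $\ell_i(\cdot;x)$ differentiable), $f_i=\frac1N\sum_kf_i^{(k)}$, $\mathbf F=(f_1,\dots,f_m)^\top$. Each $f_i^{(k)}$ is nonnegative and $L_i$-smooth: $\|\nabla f_i^{(k)}(\theta)-\nabla f_i^{(k)}(\theta')\|\le L_i\|\theta-\theta'\|$ on $\mathbb R^d$; the $L_i\ge 0$ are not all $0$. $L_w:=\sum_iL_i$. $\Delta_m$ is the probability simplex in $\mathbb R^m$. The fixed reference $\mathbf r=(r_1,\dots,r_m)$ satisfies $r_i\ge\rho>0$. $\Phi(\theta):=-\sum_i\log(r_i-f_i(\theta))$ where all $r_i-f_i(\theta)>0$. **Process.** $\theta^0$ is deterministic. In round $t=0,\dots,T-1$, $\mathcal F_t$ is the sigma-field of all randomness revealed before the client set $S_t$ is sampled; $\theta^t$ and the weight vector $w^t\in\Delta_m$ are $\mathcal F_t$-measurable. Given $\mathcal F_t$, $S_t$ is uniform among subsets of $\{1,\dots,N\}$ of size $M=pN$ (an integer $\geq 1$), independently of current-round minibatch randomness. After $S_t$ is chosen, objective reports are formed (randomness $\mathcal U_t^{\mathrm{rep}}$, see below). Then each $k\in S_t$ sets $\theta_{k,0}^t=\theta^t$ and, for $s=0,\dots,K-1$ ($K\ge1$),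 $\theta_{k,s+1}^t=\theta_{k,s}^t-\eta_\ell\sum_iw_i^tg_i^{(k)}(\theta_{k,s}^t;B_{k,s}^t)$, where $g_i^{(k)}(\theta;B)$ is the average of $\nabla\ell_i(\theta;x_{k,j})$ over the indices $j$ in $B$, and, conditionally on $\mathcal G_{t,s}:=\sigma(\mathcal F_t,S_t,\mathcal U_t^{\mathrm{rep}},\{B_{k,u}^t:k\in S_t,u<s\})$, $B_{k,s}^t$ consists of $b$ indices drawn i.i.d. uniformly with replacement from $\{1,\dots,n_k\}$ (the same minibatch is used for all tasks; no cross-client independence is assumed). The variance bound $\mathbb E[\|g_i^{(k)}(\theta_{k,s}^t;B_{k,s}^t)-\nabla f_i^{(k)}(\theta_{k,s}^t)\|^2\mid\mathcal G_{t,s}]\le\sigma_i^2$ holds. The server sets $\theta^{t+1}=\theta^t+\eta_g\frac1M\sum_{k\in S_t}(\theta_{k,K}^t-\theta^t)$. $\mathcal F_{t+1}$ contains all round-$t$ randomness. **Reports.** At $\theta^t$, each $k\in S_t$ draws (given $\mathcal F_t,S_t$) a uniformly random subset of $\{1,\dots,n_k\}$ of size $b_{k,t}^{\mathrm{rep}}$ without replacement, where $b_{k,t}^{\mathrm{rep}}=n_k$ if the configured number of report batches $q_t$ is $0$ and $b_{k,t}^{\mathrm{rep}}=\min\{q_tb,n_k\}$ if $q_t\ge1$; $\widehat f_{i,k}^{\,t}$ is the average of $\ell_i(\theta^t;x_{k,j})$ over this subset. The server forms $\widehat f_i^{\,t}=\frac1M\sum_{k\in S_t}\widehat f_{i,k}^{\,t}\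 (\ge0)$ and $\widehat{\mathbf F}^{\,t}=(\widehat f_1^{\,t},\dots,\widehat f_m^{\,t})^\top$. With $v_{i,k}(\theta)=\frac1{n_k}\sum_j(\ell_i(\theta;x_{k,j})-f_i^{(k)}(\theta))^2$ and $\gamma_{k,t}=\frac{n_k-b_{k,t}^{\mathrm{rep}}}{b_{k,t}^{\mathrm{rep}}(n_k-1)}$ ($=0$ if $n_k=1$), the quantities $\max_{t<T}\mathbb E[\frac1N\sum_k\gamma_{k,t}v_{i,k}(\theta^t)]$ and $\max_{t<T}\mathbb E[\frac1N\sum_k(f_i^{(k)}(\theta^t)-f_i(\theta^t))^2]$ are finite. **Weights.** $w^0=\frac1m\mathbf 1_m$ and, for $t\ge1$, $w_i^t=\dfrac{\max\{r_i-\widehat f_i^{\,t-1},\rho_{\mathrm{clip}}\}^{-1}}{\sum_j\max\{r_j-\widehat f_j^{\,t-1},\rho_{\mathrm{clip}}\}^{-1}}$, where $0<\rho_{\mathrm{clip}}\le\rho$. **Virtual trajectory.** $v_{t,0}=\theta^t$, $v_{t,s+1}=v_{t,s}-\eta_\ell\sum_iw_i^t\nabla f_i(v_{t,s})$, $0\le s<K$. **Safe reference.** $\mathcal D\subseteq\mathbb R^d$ is convex, $\mathcal D_\rho=\{\theta\in\mathcal D:\min_i(r_i-f_i(\theta))\ge\rho\}$, $\theta^0\in\mathcal D_\rho$. Almost surely, for every $t<T$, $\mathcal D_\rho$ contains $\theta^t,\theta^{t+1}$, all $\theta_{k,s}^t$ ($k\in S_t$, $0\le s\le K$), all $v_{t,s}$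 ($0\le s\le K$), and the segments $[\theta^t,\theta^{t+1}]$, $[\theta_{k,s}^t,v_{t,s}]$, $[v_{t,s},\theta^t]$ ($k\in S_t$, $0\le s\le K-1$). **Heterogeneity.** With $\mathsf H_i(\theta)=\frac1N\sum_k\|\nabla f_i^{(k)}(\theta)-\nabla f_i(\theta)\|^2$, almost surely for all $t<T$: $\mathsf H_i(\theta^t)\le\zeta_i^2$ and $\mathsf H_i(v_{t,s})\le\zeta_i^2$ for $0\le s\le K$. **Smoothness of $\Phi$.** $L_\Phi>0$ is a constant with $L_\Phi\le\sum_iL_i/\rho+\sum_i2L_ir_i/\rho^2$ such that $\|\nabla\Phi(\theta)-\nabla\Phi(\theta')\|\le L_\Phi\|\theta-\theta'\|$ whenever $[\theta,\theta']\subseteq\mathcal D_\rho$. **Stepsizes.** $c_{\min}:=\sum_i1/r_i$, $c_{\max}:=m/\rho$; $\eta_\ell,\eta_g>0$ satisfy $\eta_\ell K\le\frac1{4L_w}$ and $\eta_g\eta_\ell K\le\frac{c_{\min}^2}{48\,c_{\max}L_\Phi}$. *)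

(* Defs.v *)
From HB Require Import structures.
From mathcomp Require Export all_boot all_order all_algebra.
From mathcomp Require Export all_classical all_reals all_analysis.
Export Order.TTheory GRing.Theory Num.Theory.
Export numFieldNormedType.Exports.

Set Implicit Arguments.
Unset Strict Implicit.
Unset Printing Implicit Defensive.

Local Open Scope classical_set_scope.
Local Open Scope ring_scope.

(* The library's norm on 'rV[R]_d is the sup norm, hence this definition. *)
Definition enorm (R : realType) (d : nat) (v : 'rV[R]_d) : R :=
  Num.sqrt (\sum_j v 0 j ^+ 2).

Definition grad (R : realType) (d : nat) (f : 'rV[R]_d -> R) (u : 'rV[R]_d)
    : 'rV[R]_d :=
  \row_j 'D_(delta_mx 0 j) f u.

Definition segment (R : realType) (d : nat) (u v : 'rV[R]_d) : set 'rV[R]_d :=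
  [set (1 - a) *: u + a *: v | a in `[0, 1]%classic].

(* In what follows a sub-sigma-field is given as its set of events. *)

Definition measurable_wrt (T : Type) (R : realType) (G : set (set T))
    (Y : T -> R) : Prop :=
  forall B : set R, measurable B -> G (Y @^-1` B).

(* Y is a version of E[X | G]. *)
Definition is_cond_exp (disp : measure_display) (T : measurableType disp)
    (R : realType) (P : probability T R) (G : set (set T)) (X Y : T -> R)
    : Prop :=
  [/\ P.-integrable setT (EFin \o X),
      P.-integrable setT (EFin \o Y),
      measurable_wrt G Y &
      forall A, G A ->
        (\int[P]_(x in A) (Y x)%:E = \int[P]_(x in A) (X x)%:E)%E].

(* P(E | G) = p almost surely on the event A. *)
Definition cond_prob_on (disp : measure_display) (T : measurableType disp)
    (R : realType) (P : probability T R) (G : set (set T)) (A E : set T)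
    (p : R) : Prop :=
  exists2 Y : T -> R, is_cond_exp P G (\1_E) Y &
    \forall x \ae P, A x -> Y x = p.

(* P(E1 `&` E2 | G) = P(E1 | G) P(E2 | G) almost surely. *)
Definition cond_indep_events (disp : measure_display)
    (T : measurableType disp) (R : realType) (P : probability T R)
    (G : set (set T)) (E1 E2 : set T) : Prop :=
  exists Y1 Y2 : T -> R,
    [/\ is_cond_exp P G (\1_E1) Y1, is_cond_exp P G (\1_E2) Y2 &
        is_cond_exp P G (\1_(E1 `&` E2)) (fun x => Y1 x * Y2 x)].

Definition discrete_rv (disp : measure_display) (T : measurableType disp)
    (V : Type) (X : T -> V) : Prop :=
  forall v, measurable [set x | X x = v].

(* nk examples for each of the N clients, m tasks, parameters in R^d, local
   minibatches of b indices, M sampled clients and K local steps; crep t is the configured number of report batches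
   in round t. *)
Record setup (R : realType) (X : Type) (d N m nk b M K : nat) := Setup {
  loss : 'I_m -> 'rV[R]_d -> X -> R;
  example : 'I_N -> 'I_nk -> X;
  rref : 'I_m -> R;
  rclip : R;
  etal : R;
  etag : R;
  theta0 : 'rV[R]_d;
  crep : nat -> nat }.

Section Objectives.
Context {R : realType} {X : Type} {d N m nk b M K : nat}.
Variable c : setup R X d N m nk b M K.

Definition client_obj (k : 'I_N) (i : 'I_m) (u : 'rV[R]_d) : R :=
  nk%:R^-1 * \sum_(j < nk) loss c i u (example c k j).

Definition obj (i : 'I_m) (u : 'rV[R]_d) : R :=
  N%:R^-1 * \sum_(k < N) client_obj k i u.

(* ln is total, with value 0 outside the positive reals; Phi is meaningful
   where obj i u < rref c i for all i. *)
Definition Phi (u : 'rV[R]_d) : R := - \sum_i ln (rref c i - obj i u).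

Definition safe_set (D : set 'rV[R]_d) (rho : R) : set 'rV[R]_d :=
  [set u | D u /\ forall i, rho <= rref c i - obj i u].

Definition heterogeneity (i : 'I_m) (u : 'rV[R]_d) : R :=
  N%:R^-1 *
    \sum_(k < N) enorm (grad (client_obj k i) u - grad (obj i) u) ^+ 2.

Definition batch_grad (k : 'I_N) (i : 'I_m) (u : 'rV[R]_d)
    (B : {ffun 'I_b -> 'I_nk}) : 'rV[R]_d :=
  b%:R^-1 *:
    \sum_(l < b) grad (fun u' => loss c i u' (example c k (B l))) u.

(* theta_{k,s}, started at u with weights w and minibatches B 0, B 1, etc. *)
Fixpoint local_iter (k : 'I_N) (u : 'rV[R]_d) (w : 'I_m -> R)
    (B : nat -> {ffun 'I_b -> 'I_nk}) (s : nat) : 'rV[R]_d :=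
  if s is s'.+1 then
    let v := local_iter k u w B s' in
    v - etal c *: \sum_i w i *: batch_grad k i v (B s')
  else u.

Fixpoint virtual_iter (u : 'rV[R]_d) (w : 'I_m -> R) (s : nat) : 'rV[R]_d :=
  if s is s'.+1 then
    let v := virtual_iter u w s' in
    v - etal c *: \sum_i w i *: grad (obj i) v
  else u.

Definition server_step (u : 'rV[R]_d) (w : 'I_m -> R) (S : {set 'I_N})
    (B : 'I_N -> nat -> {ffun 'I_b -> 'I_nk}) : 'rV[R]_d :=
  u + etag c *: (M%:R^-1 *:
        \sum_(k in S) (local_iter k u w (B k) K - u)).

Definition report_size (t : nat) : nat :=
  if crep c t == 0%N then nk else minn (crep c t * b) nk.

Definition client_report (u : 'rV[R]_d) (k : 'I_N) (A : {set 'I_nk})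
    (i : 'I_m) : R :=
  #|A|%:R^-1 * \sum_(j in A) loss c i u (example c k j).

Definition server_report (u : 'rV[R]_d) (S : {set 'I_N})
    (A : 'I_N -> {set 'I_nk}) (i : 'I_m) : R :=
  M%:R^-1 * \sum_(k in S) client_report u k (A k) i.

Definition weights (fhat : 'I_m -> R) (i : 'I_m) : R :=
  (Num.max (rref c i - fhat i) (rclip c))^-1 /
    \sum_j (Num.max (rref c j - fhat j) (rclip c))^-1.

Definition loss_variance (i : 'I_m) (k : 'I_N) (u : 'rV[R]_d) : R :=
  nk%:R^-1 *
    \sum_(j < nk) (loss c i u (example c k j) - client_obj k i u) ^+ 2.

Definition gamma (t : nat) : R :=
  if nk == 1%N then 0
  else (nk%:R - (report_size t)%:R) / ((report_size t)%:R * (nk%:R - 1)).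

End Objectives.

(* The report subset and the minibatches are random variables for every client;
   the process uses those of the sampled clients only. *)
Record draws (Om : Type) (N nk b : nat) := Draws {
  clients : nat -> Om -> {set 'I_N};
  reports : nat -> 'I_N -> Om -> {set 'I_nk};
  batches : nat -> 'I_N -> nat -> Om -> {ffun 'I_b -> 'I_nk} }.

Section Process.
Context {R : realType} {X Om : Type} {d N m nk b M K : nat}.
Variables (c : setup R X d N m nk b M K) (D : draws Om N nk b).

(* The pair (theta^t, w^t). *)
Fixpoint state (x : Om) (t : nat) : 'rV[R]_d * ('I_m -> R) :=
  if t is t'.+1 then
    let: (u, w) := state x t' in
    (server_step c u w (clients D t' x) (fun k s => batches D t' k s x),
     weights c
       (server_report c u (clients D t' x) (fun k => reports D t' k x)))
  else (theta0 c, fun=> m%:R^-1).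

Definition theta (t : nat) (x : Om) : 'rV[R]_d := (state x t).1.

Definition weight (t : nat) (x : Om) : 'I_m -> R := (state x t).2.

Definition local_theta (t : nat) (k : 'I_N) (s : nat) (x : Om) : 'rV[R]_d :=
  local_iter c k (theta t x) (weight t x) (fun u => batches D t k u x) s.

Definition virtual_theta (t s : nat) (x : Om) : 'rV[R]_d :=
  virtual_iter c (theta t x) (weight t x) s.

Definition fhat (t : nat) (x : Om) (i : 'I_m) : R :=
  server_report c (theta t x) (clients D t x) (fun k => reports D t k x) i.

Definition report_error (t : nat) (x : Om) : R :=
  \big[Num.max/0]_(i < m) `|fhat t x i - obj c i (theta t x)|.

Definition client_events (t : nat) : set (set Om) :=
  [set E | exists A, E = [set x | clients D t x = A]].

(* These two generate only what the sampled clients reveal: {reports t k : k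
   in S_t}, resp. {batches t k u : k in S_t, u < s}. *)
Definition report_events (t : nat) : set (set Om) :=
  [set E | exists k A,
     E = [set x | k \in clients D t x /\ reports D t k x = A]].

Definition batch_events (t s : nat) : set (set Om) :=
  [set E | exists k u B, (u < s)%N /\
     E = [set x | k \in clients D t x /\ batches D t k u x = B]].

(* sigma(F_t, S_t) and G_{t,s}, for a filtration F. *)
Definition sigma_clients (F : nat -> set (set Om)) (t : nat) : set (set Om) :=
  <<s F t `|` client_events t >>.

Definition sigma_local (F : nat -> set (set Om)) (t s : nat)
    : set (set Om) :=
  <<s F t `|` client_events t `|` report_events t `|` batch_events t s >>.

End Process.

Definition chi {R : realType} (N M : nat) : R :=
  (N%:R - M%:R) / (M%:R * (N%:R - 1)).

(* Main.v *)
Require Import Defs.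
From mathcomp Require Import ring lra.

Set Implicit Arguments.
Unset Strict Implicit.
Unset Printing Implicit Defensive.

Local Open Scope classical_set_scope.
Local Open Scope ring_scope.

(* All quantities are functions of the finitely many draws of the first T
   rounds. Expectations are therefore finite sums over draw histories, each
   history of positive mass being represented by an outcome [rep w] at which
   the almost sure assumptions hold; conditioning on F_t or G_{t,s} enters only
   through the masses of the events that fix theta^t, w^t and the earlier
   minibatches.

   In one round, theta^{t+1} - theta^t = - eta_eff (noise + drift bias + sampled
   gradient). The noise is a martingale difference in s and is averaged over the
   clients by convexity. The drift satisfies
   E (1/M) sum_{k in S_t} |theta_{k,s} - theta^t|^2 <= s^2 eta_l^2 Gbar^2,
   by induction on s with the heterogeneity bound at theta^t. The sampled
   gradient has mean grad F_{w^t}(theta^t) and variance at most chi_N(M) zeta^2.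

   The gradient of Phi is c grad F_{w*}, where c = sum_i 1/(r_i - f_i) lies in
   [c_min, c_max] and w* are the weights computed from the exact objectives.
   Descent along Phi thus gains |grad Phi|^2 / c_max up to the weight error
   |w^t - w*|_1, and w is C-Lipschitz in the reports, so that this error is at
   most C times the report error of the previous round plus Gmax times the
   previous displacement. Telescoping gives the rate. *)

(** * Euclidean norm and smooth functions *)

Section Euclid.
Context {R : realType} {d : nat}.
Implicit Types (u v w : 'rV[R]_d) (a : R).

(** A minibatch has its prescribed law only on the event that its client is sampled. Every noise
    identity is therefore stated for one client under the indicator of [k \in S_t]; clients are
    combined by convexity alone, so that Sigma^2/K carries no factor 1/M.

    The weights lag by one round: w^{t+1} is computed from reports at theta^t but compared with the
    exact weights at theta^{t+1}. The displacement that enters this comparison is bounded through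
    |grad F_w| <= Gmax and not through grad Phi, so that no gradient term has to be absorbed in the
    next round; the price is the term A_6. Round 0 has no report behind it: its squared weight error
    is at most 4 and is paid once, whence A_7/T.

    Of the gain 3/4 that remains after the weight error, 1/6 pays for the drift and 1/8 for the
    second-order term; the 48 in the stepsize bound secures the latter. At least 1/4 survives, hence
    A_1 = 4 c_max. E_wt collects c_max from the linear term and 6 L_Phi eta from the second-order
    term. *)

Definition dot u v : R := \sum_j u 0 j * v 0 j.

Definition nsq u : R := dot u u.

Lemma dotC u v : dot u v = dot v u.
Proof. by apply: eq_bigr => j _; rewrite mulrC. Qed.

Lemma dotDl u v w : dot (u + v) w = dot u w + dot v w.
Proof. by rewrite /dot -big_split /=; apply: eq_bigr => j _; rewrite mxE mulrDl. Qed.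

Lemma dotZl a u v : dot (a *: u) v = a * dot u v.
Proof. by rewrite /dot mulr_sumr; apply: eq_bigr => j _; rewrite mxE mulrA. Qed.

Lemma dotDr u v w : dot u (v + w) = dot u v + dot u w.
Proof. by rewrite dotC dotDl !(dotC u). Qed.

Lemma dotZr a u v : dot u (a *: v) = a * dot u v.
Proof. by rewrite dotC dotZl dotC. Qed.

Lemma dotNl u v : dot (- u) v = - dot u v.
Proof. by rewrite -scaleN1r dotZl mulN1r. Qed.

Lemma dotNr u v : dot u (- v) = - dot u v.
Proof. by rewrite dotC dotNl dotC. Qed.

Lemma dot0l v : dot 0 v = 0.
Proof. by rewrite -(scale0r 0) dotZl mul0r. Qed.

Lemma dot_suml (I : Type) (r : seq I) (p : pred I) (f : I -> 'rV[R]_d) v :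
  dot (\sum_(i <- r | p i) f i) v = \sum_(i <- r | p i) dot (f i) v.
Proof.
by elim/big_rec2: _ => [|i x y _ <-]; rewrite ?dot0l// dotDl.
Qed.

Lemma dot_sumr (I : Type) (r : seq I) (p : pred I) (f : I -> 'rV[R]_d) v :
  dot v (\sum_(i <- r | p i) f i) = \sum_(i <- r | p i) dot v (f i).
Proof. by rewrite dotC dot_suml; apply: eq_bigr => i _; rewrite dotC. Qed.

Lemma nsq_ge0 u : 0 <= nsq u.
Proof. by apply: sumr_ge0 => j _; rewrite -expr2 sqr_ge0. Qed.

Lemma nsqE u : nsq u = \sum_j u 0 j ^+ 2.
Proof. by apply: eq_bigr => j _; rewrite expr2. Qed.

Lemma enorm_sqr u : enorm u ^+ 2 = nsq u.
Proof. by rewrite /enorm -nsqE sqr_sqrtr// nsq_ge0. Qed.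

Lemma enorm_ge0 u : 0 <= enorm u.
Proof. exact: sqrtr_ge0. Qed.

Lemma nsqD u v : nsq (u + v) = nsq u + 2 * dot u v + nsq v.
Proof. by rewrite /nsq dotDl !dotDr (dotC v u); ring. Qed.

Lemma nsqZ a u : nsq (a *: u) = a ^+ 2 * nsq u.
Proof. by rewrite /nsq dotZl dotZr; ring. Qed.

Lemma nsqN u : nsq (- u) = nsq u.
Proof. by rewrite /nsq dotNl dotNr opprK. Qed.

Lemma nsq0 : nsq 0 = 0.
Proof. exact: dot0l. Qed.

Lemma nsqB u v : nsq (u - v) = nsq u - 2 * dot u v + nsq v.
Proof. by rewrite nsqD nsqN dotNr; ring. Qed.

(* Expanding [0 <= nsq (a *: u - v)]. *)
Lemma dot_young a u v : 0 < a -> dot u v <= a / 2 * nsq u + (2 * a)^-1 * nsq v.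
Proof.
move=> a0; have := nsq_ge0 (a *: u - v); rewrite nsqB nsqZ dotZl => h.
rewrite -(ler_pM2l a0) -subr_ge0.
rewrite (_ : _ - _ = (a ^+ 2 * nsq u - 2 * (a * dot u v) + nsq v) / 2); last first.
  by field; rewrite gt_eqF.
lra.
Qed.

Lemma nsqD_young a u v : 0 < a ->
  nsq (u + v) <= (1 + a) * nsq u + (1 + a^-1) * nsq v.
Proof.
move=> a0; rewrite nsqD; have := dot_young u v a0.
by rewrite invfM; lra.
Qed.

(** Expanding [0 <= nsq (dot u v *: u - nsq u *: v)] gives the claim times [nsq u]; the case
    [nsq u = 0] is separate. *)
Lemma cauchy_schwarz u v : dot u v ^+ 2 <= nsq u * nsq v.
Proof.
have [u0|u0] := eqVneq (nsq u) 0.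
  have h0 : u = 0.
    apply/rowP => j; rewrite mxE; move/eqP: u0; rewrite nsqE psumr_eq0; last first.
      by move=> i _; rewrite sqr_ge0.
    by move=> /allP/(_ j); rewrite mem_index_enum sqrf_eq0 => /(_ isT)/eqP.
  by rewrite h0 dot0l nsq0 mul0r expr0n.
have up : 0 < nsq u by rewrite lt_neqAle eq_sym u0 nsq_ge0.
have := nsq_ge0 ((dot u v) *: u - (nsq u) *: v).
rewrite nsqB !nsqZ dotZl dotZr => h.
rewrite -(ler_pM2l up); lra.
Qed.

Lemma dot_le_enorm u v : dot u v <= enorm u * enorm v.
Proof.
have [h|h] := lerP (dot u v) 0.
  by rewrite (le_trans h)// mulr_ge0// enorm_ge0.
rewrite -(ler_pXn2r (n := 2))// ?nnegrE ?(ltW h) ?mulr_ge0 ?enorm_ge0//.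
by rewrite exprMn !enorm_sqr cauchy_schwarz.
Qed.

Lemma enorm_leP a u : 0 <= a -> (enorm u <= a) = (nsq u <= a ^+ 2).
Proof.
by move=> a0; rewrite -(ler_pXn2r (n := 2))// ?nnegrE ?enorm_ge0// enorm_sqr.
Qed.

(** Each [dot (f i) (f j)] is at most the mean of the two squared norms in absolute value. Signed
    coefficients are allowed because differences of weight vectors occur as coefficients. *)
Lemma nsq_wsum (I : finType) (p : pred I) (a : I -> R) (f : I -> 'rV[R]_d) :
  nsq (\sum_(i | p i) a i *: f i) <=
    (\sum_(i | p i) `|a i|) * \sum_(i | p i) `|a i| * nsq (f i).
Proof.
rewrite /nsq dot_suml.
under eq_bigr => i _ do rewrite dotZl dot_sumr mulr_sumr.
(* The right-hand side symmetrised in [i] and [j], so that both sides compare term by term. *)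
have -> : (\sum_(i | p i) `|a i|) * (\sum_(i | p i) `|a i| * dot (f i) (f i)) =
  \sum_(i | p i) \sum_(j | p j)
     (`|a i| * `|a j| * nsq (f i) / 2 + `|a i| * `|a j| * nsq (f j) / 2).
  pose q i j := `|a i| * `|a j| * nsq (f j) / 2.
  transitivity (\sum_(i | p i) \sum_(j | p j) (q i j + q i j)).
    rewrite mulr_suml; apply: eq_bigr => i _.
    rewrite mulr_sumr; apply: eq_bigr => j _.
    by rewrite /q /nsq; field.
  transitivity (\sum_(i | p i) \sum_(j | p j) q j i +
                \sum_(i | p i) \sum_(j | p j) q i j).
    rewrite [X in _ = X + _]exchange_big /= -big_split /=.
    by apply: eq_bigr => i _; rewrite -big_split.
  rewrite -big_split; apply: eq_bigr => i _; rewrite -big_split.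
  by apply: eq_bigr => j _; rewrite /q /= (mulrC `|a j|).
apply: ler_sum => i _; apply: ler_sum => j _.
rewrite dotZr.
have h : `|dot (f i) (f j)| <= nsq (f i) / 2 + nsq (f j) / 2.
  rewrite ler_norml; apply/andP; split.
    by have := nsq_ge0 (f i + f j); rewrite nsqD; lra.
  by have := nsq_ge0 (f i - f j); rewrite nsqB; lra.
apply: le_trans (ler_norm _) _; rewrite !normrM mulrA.
have := ler_wpM2l (mulr_ge0 (normr_ge0 (a i)) (normr_ge0 (a j))) h.
lra.
Qed.

Lemma nsq_sum (I : finType) (p : pred I) (f : I -> 'rV[R]_d) :
  nsq (\sum_(i | p i) f i) <= #|p|%:R * \sum_(i | p i) nsq (f i).
Proof.
have := nsq_wsum p (fun=> 1) f.
rewrite normr1; under eq_bigr => i _ do rewrite scale1r.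
under [X in _ <= _ * X -> _]eq_bigr => i _ do rewrite mul1r.
by rewrite sumr_const.
Qed.

Lemma nsq_convex (I : finType) (p : pred I) (a : I -> R) (f : I -> 'rV[R]_d) :
  (forall i, p i -> 0 <= a i) -> \sum_(i | p i) a i <= 1 ->
  nsq (\sum_(i | p i) a i *: f i) <= \sum_(i | p i) a i * nsq (f i).
Proof.
move=> a0 a1; have h := nsq_wsum p a f.
have e1 : \sum_(i | p i) `|a i| = \sum_(i | p i) a i.
  by apply: eq_bigr => i pi; rewrite ger0_norm// a0.
have e2 : \sum_(i | p i) `|a i| * nsq (f i) = \sum_(i | p i) a i * nsq (f i).
  by apply: eq_bigr => i pi; rewrite ger0_norm// a0.
move: h; rewrite e1 e2 => h.
apply: le_trans h _; rewrite ler_piMl// sumr_ge0// => i pi.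
by rewrite mulr_ge0 ?a0 ?nsq_ge0.
Qed.

Lemma nsqD3 u v w : nsq (u + v + w) <= 3 * (nsq u + nsq v + nsq w).
Proof.
have h1 := nsq_ge0 (u - v); have h2 := nsq_ge0 (u - w).
have h3 := nsq_ge0 (v - w).
by move: h1 h2 h3; rewrite !nsqB !nsqD dotDl; lra.
Qed.

Lemma nsqD2 u v : nsq (u + v) <= 2 * (nsq u + nsq v).
Proof. by have := nsq_ge0 (u - v); rewrite nsqB nsqD; lra. Qed.

End Euclid.

(** * Gradients, the mean value theorem and smoothness bounds *)

Section Calculus.
Context {R : realType} {d : nat}.
Implicit Types (u v h : 'rV[R]_d) (f g : 'rV[R]_d -> R).

Lemma derive_grad f u h : differentiable f u -> 'D_h f u = dot (grad f u) h.
Proof.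
move=> df; rewrite deriveE// {1}(row_sum_delta h) linear_sum /=.
by apply: eq_bigr => j _; rewrite linearZ /= mxE deriveE// mulrC.
Qed.

Lemma is_derive_line f u h (a : R) : differentiable f (u + a *: h) ->
  is_derive a 1 (fun b : R => f (u + b *: h)) (dot (grad f (u + a *: h)) h).
Proof.
move=> df; rewrite -derive_grad//.
(* The difference quotient on the line is that of [f] in direction [h]. *)
have e : (fun b : R => b^-1 *: (f (u + (b *: 1 + a) *: h) - f (u + a *: h))) =
         (fun b : R => b^-1 *: (f (b *: h + (u + a *: h)) - f (u + a *: h))).
  apply/funext => b; congr (_ *: (f _ - _)).
  by rewrite /GRing.scale /= mulr1 -!/(GRing.scale _ _) scalerDl addrCA.
apply: DeriveDef; last by rewrite /derive /= e.
rewrite /derivable /= e; exact: (diff_derivable (v := h) df).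
Qed.

Lemma mvt_line f u h : (forall a : R, 0 <= a <= 1 -> differentiable f (u + a *: h)) ->
  exists2 a : R, 0 <= a <= 1 & f (u + h) - f u = dot (grad f (u + a *: h)) h.
Proof.
move=> df.
have dP (a : R) : a \in `[0, 1]%R -> is_derive a 1 (fun b : R => f (u + b *: h))
    (dot (grad f (u + a *: h)) h).
  by move=> /itvP ai; apply: is_derive_line; apply: df; rewrite !ai.
have [a aI] := @MVT_segment R _ (fun b => dot (grad f (u + b *: h)) h) 0 1
  ler01 (fun a ai => dP a (subset_itv_oo_cc ai))
  (derivable_within_continuous (fun a ai => @ex_derive _ _ _ _ _ _ _ (dP a ai))).
by rewrite scale1r scale0r addr0 subr0 mulr1 => ->; exists a.
Qed.

(** The mean value theorem for [psi], the difference of [f] and its quadratic model along the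
    segment, whose derivative is nonpositive. Smoothness is asked on this segment only, so that the
    lemma applies to [Phi] as well. *)
Lemma smooth_upper_bound f u h (L : R) :
  (forall a : R, 0 <= a <= 1 -> differentiable f (u + a *: h)) ->
  (forall a : R, 0 <= a <= 1 ->
     enorm (grad f (u + a *: h) - grad f u) <= L * enorm (a *: h)) ->
  f (u + h) <= f u + dot (grad f u) h + L / 2 * nsq h.
Proof.
move=> df sm.
pose psi (b : R) := f (u + b *: h) - b * dot (grad f u) h - b ^+ 2 * (L / 2 * nsq h).
pose dpsi (b : R) := dot (grad f (u + b *: h)) h - dot (grad f u) h
  - (2 * b) * (L / 2 * nsq h).
have dP (a : R) : 0 <= a <= 1 -> is_derive a 1 psi (dpsi a).
  move=> /df/is_derive_line h1.
  have -> : psi = (fun b : R => f (u + b *: h)) - (fun b : R => b) * cst (dot (grad f u) h)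
     - (fun b : R => b) ^+ 2 * cst (L / 2 * nsq h).
    by apply/funext => b; rewrite /psi !fctE /=.
  apply: is_derive_eq; rewrite /dpsi /GRing.scale /= !fctE.
  ring.
have dI (a : R) : a \in `[0, 1]%R -> is_derive a 1 psi (dpsi a).
  by move=> /itvP ai; apply: dP; rewrite !ai.
have [a aI] := @MVT_segment R psi dpsi 0 1 ler01
  (fun a ai => dI a (subset_itv_oo_cc ai))
  (derivable_within_continuous (fun a ai => @ex_derive _ _ _ _ _ _ _ (dI a ai))).
have ai : 0 <= a <= 1 by move: aI; rewrite in_itv.
rewrite /psi !scale0r scale1r addr0 subr0 mulr1 mul1r expr0n expr1n !mul0r !mul1r !subr0.
have le0 : dpsi a <= 0.
  rewrite /dpsi -dotNl -dotDl subr_le0.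
  apply: le_trans (dot_le_enorm _ _) _.
  apply: le_trans (ler_wpM2r (enorm_ge0 h) (sm a ai)) _.
  have -> : enorm (a *: h) = a * enorm h.
    rewrite /enorm -!nsqE nsqZ sqrtrM ?sqr_ge0// sqrtr_sqr ger0_norm//.
    by case/andP: ai.
  by rewrite -enorm_sqr le_eqVlt; apply/orP; left; apply/eqP; field.
by move=> e; rewrite -e in le0; lra.
Qed.

(* The bound with [L'] in place of [L] covers the degenerate case [L = 0]. *)
Lemma self_bounding f u (L : R) : 0 <= L ->
  (forall v, differentiable f v) -> (forall v, 0 <= f v) ->
  (forall v w, enorm (grad f v - grad f w) <= L * enorm (v - w)) ->
  nsq (grad f u) <= 2 * L * f u.
Proof.
move=> L0 df f0 sm.
have key (L' : R) : 0 < L' -> L <= L' -> nsq (grad f u) <= 2 * L' * f u.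
  move=> L'0 LL'.
  (* The upper bound at the gradient step of length 1/L', where [f] is still nonnegative. *)
  have := @smooth_upper_bound f u (- L'^-1 *: grad f u) L'.
  have -> : dot (grad f u) (- L'^-1 *: grad f u) = - L'^-1 * nsq (grad f u).
    by rewrite dotZr.
  rewrite nsqZ => sub.
  have := le_trans (f0 _) (sub _ _) => h.
  have {}h : 0 <= f u + - L'^-1 * nsq (grad f u)
               + L' / 2 * ((- L'^-1) ^+ 2 * nsq (grad f u)).
    apply: h => // a ai.
    set w := a *: _; have := sm (u + w) u.
    have -> : u + w - u = w by rewrite addrC addKr.
    move=> /le_trans; apply.
    by rewrite ler_wpM2r// enorm_ge0.
  rewrite -subr_ge0 (_ : _ - _ = 2 * L' * (f u + - L'^-1 * nsq (grad f u)
               + L' / 2 * ((- L'^-1) ^+ 2 * nsq (grad f u)))).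
    by rewrite mulr_ge0// mulr_ge0// ltW.
  by field; rewrite gt_eqF.
apply/ler_addgt0Pr => e e0.
have fp : 0 < 2 * (f u + 1) by have := f0 u; lra.
(* With this choice the excess over [2 * L * f u] is [e * (f u / (f u + 1))], at most [e]. *)
have := key (L + e / (2 * (f u + 1))).
have e' : 0 < e / (2 * (f u + 1)) by rewrite divr_gt0.
move=> /(_ (ltr_wpDl L0 e')); rewrite lerDl (ltW e') => /(_ isT) h.
apply: le_trans h _; rewrite mulrDr mulrDl lerD2l.
rewrite (_ : 2 * _ * _ = e * (f u / (f u + 1))); last by field; lra.
by rewrite ler_piMr ?(ltW e0)// ler_pdivrMr ?mul1r; have := f0 u; lra.
Qed.

Lemma lincombE (I : finType) (p : pred I) (a : I -> R) (f : I -> 'rV[R]_d -> R) :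
  (fun v => \sum_(i | p i) a i * f i v) = \sum_(i | p i) (a i *: f i).
Proof. by apply/funext => v; rewrite fct_sumE. Qed.

Lemma differentiable_lincomb (I : finType) (p : pred I) (a : I -> R)
    (f : I -> 'rV[R]_d -> R) u :
  (forall i, differentiable (f i) u) ->
  differentiable (fun v => \sum_(i | p i) a i * f i v) u.
Proof.
move=> df; rewrite lincombE; elim/big_rec: _ => [|i g _ dg]; first exact: differentiable_cst.
by apply: differentiableD => //; apply: differentiableZ.
Qed.

Lemma grad_lincomb (I : finType) (p : pred I) (a : I -> R) (f : I -> 'rV[R]_d -> R) u :
  (forall i, differentiable (f i) u) ->
  grad (fun v => \sum_(i | p i) a i * f i v) u = \sum_(i | p i) a i *: grad (f i) u.
Proof.
move=> df; apply/rowP => j; rewrite mxE summxE.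
under [RHS]eq_bigr => i _ do rewrite !mxE.
rewrite lincombE.
have [] : is_derive u (delta_mx 0 j) (\sum_(i | p i) (a i *: f i))
  (\sum_(i | p i) a i * 'D_(delta_mx 0 j) (f i) u); last by move=> _ ->.
elim/big_rec2: _ => [|i y g _ dg]; first exact: is_derive_cst.
have di : is_derive u (delta_mx 0 j) (f i) ('D_(delta_mx 0 j) (f i) u).
  by apply: DeriveDef => //; apply: diff_derivable.
exact: is_deriveD.
Qed.

Lemma differentiable_ln_comp g u : 0 < g u -> differentiable g u ->
  differentiable (fun v => ln (g v)) u.
Proof.
move=> g0 dg; apply: (differentiable_comp dg).
by apply/derivable1_diffP; apply: ex_derive; exact: is_derive1_ln.
Qed.

Lemma grad_ln_comp g u : 0 < g u -> differentiable g u ->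
  grad (fun v => ln (g v)) u = (g u)^-1 *: grad g u.
Proof.
move=> g0 dg; apply/rowP => j; rewrite !mxE.
have dl : differentiable (@ln R) (g u).
  by apply/derivable1_diffP; apply: ex_derive; exact: is_derive1_ln.
rewrite deriveE; last exact: differentiable_ln_comp.
have key (y : R) : 'd (@ln R) (g u) y = y * (g u)^-1.
  rewrite -[in LHS](mulr1 y) -/(GRing.scale y 1 : R) linearZ /= -deriveE//.
  by have [_ ->] := is_derive1_ln g0.
by rewrite (diff_comp dg dl) /= key -deriveE// mulrC.
Qed.

End Calculus.

(** * Sampling clients and minibatches *)

Section Sampling.
Context {R : realType}.

(** The sum is an expanded product of sums, with [f] at coordinate [l] and 1 at the other [b.-1]
    coordinates, each of which contributes a factor [n]. *)
Lemma sum_ffun_coord (n b : nat) (l : 'I_b) (f : 'I_n -> R) :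
  \sum_(B : {ffun 'I_b -> 'I_n}) f (B l) = n%:R ^+ b.-1 * \sum_j f j.
Proof.
pose F (i : 'I_b) (j : 'I_n) : R := if i == l then f j else 1.
have : \prod_i \sum_j F i j = \sum_(B : {ffun 'I_b -> 'I_n}) \prod_i F i (B i).
  exact: bigA_distr_bigA.
rewrite /F (bigD1 l) //= eqxx.
rewrite [X in _ * X](eq_bigr (fun=> n%:R : R)) => [|i il]; last first.
  by rewrite (negbTE il) sumr_const cardT size_enum_ord.
rewrite prodr_const.
have -> : #|[pred i | i != l]| = b.-1 by rewrite cardC1 card_ord.
rewrite mulrC => ->; apply: eq_bigr => B _.
by rewrite (bigD1 l) //= eqxx big1 ?mulr1// => i /negbTE il; rewrite il.
Qed.

Lemma minibatch_mean (n b : nat) (f : 'I_n -> R) : (0 < n)%N -> (0 < b)%N ->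
  \sum_(B : {ffun 'I_b -> 'I_n}) (n%:R ^+ b)^-1 * (b%:R^-1 * \sum_(l < b) f (B l))
  = n%:R^-1 * \sum_j f j.
Proof.
move=> n0 b0; rewrite -mulr_sumr -mulr_sumr exchange_big /=.
under eq_bigr => l _ do rewrite sum_ffun_coord.
have nn : n%:R != 0 :> R by rewrite pnatr_eq0 -lt0n.
have bn : b%:R != 0 :> R by rewrite pnatr_eq0 -lt0n.
have -> : n%:R ^+ b = n%:R * n%:R ^+ b.-1 :> R by rewrite -exprS prednK.
rewrite sumr_const card_ord -[_ *+ _]mulr_natr.
by field; rewrite nn bn mul1r expf_neq0.
Qed.

Lemma minibatch_weight (n b : nat) : (0 < n)%N ->
  \sum_(B : {ffun 'I_b -> 'I_n}) (n%:R ^+ b)^-1 = 1 :> R.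
Proof.
move=> n0; rewrite sumr_const card_ffun !card_ord -[_ *+ _]mulr_natr natrX mulVf//.
by rewrite expf_neq0// pnatr_eq0 -lt0n.
Qed.

(** * Uniform draws of [M] among [N] clients *)

Section Clients.
Variables (N M : nat).
Hypothesis (MN : (M <= N)%N).

Definition unif_draw (A : {set 'I_N}) : R :=
  if #|A| == M then 'C(N, M)%:R^-1 else 0.

(** Sets that avoid [Y] are the [M]-subsets of its complement. Avoidance probabilities are single
    binomial quotients, which is why they are preferred to inclusion probabilities. *)
Lemma unif_draw_avoid (Y : {set 'I_N}) :
  \sum_(A : {set 'I_N}) unif_draw A * (A \subset ~: Y)%:R
  = 'C(N - #|Y|, M)%:R / 'C(N, M)%:R.
Proof.
have -> : (N - #|Y|)%N = #|~: Y| by rewrite [RHS]cardsCs finset.setCK card_ord.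
rewrite -cards_draws -sum1dep_card natr_sum mulr_suml [RHS]big_mkcond /=.
apply: eq_bigr => A _; rewrite /unif_draw.
by case: ifP; case: (_ \subset _) => /=; rewrite ?mulr1 ?mulr0 ?mul0r ?mul1r.
Qed.

Lemma unif_draw_sum : \sum_(A : {set 'I_N}) unif_draw A = 1.
Proof.
have := unif_draw_avoid finset.set0; rewrite cards0 subn0 divff; last first.
  by rewrite pnatr_eq0 -lt0n bin_gt0.
by move=> <-; apply: eq_bigr => A _; rewrite finset.setC0 finset.subsetT mulr1.
Qed.

Lemma unif_draw_avoid1 (k : 'I_N) :
  \sum_(A : {set 'I_N}) unif_draw A * (k \notin A)%:R = (N%:R - M%:R) / N%:R.
Proof.
have N0 : (0 < N)%N by apply: leq_ltn_trans (ltn_ord k).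
have := unif_draw_avoid [set k]%SET; rewrite cards1 subn1 => e.
transitivity (\sum_(A : {set 'I_N}) unif_draw A * (A \subset ~: [set k]%SET)%:R).
  apply: eq_bigr => A _; congr (_ * _%:R).
  by rewrite finset.subsetC finset.sub1set inE.
rewrite e; have := mul_bin_down N M => /(congr1 (fun n => n%:R : R)).
rewrite !natrM natrB// => h.
apply/eqP; rewrite eqr_div ?pnatr_eq0 -?lt0n ?bin_gt0//.
by rewrite mulrC h mulrC mulrC.
Qed.

Lemma unif_draw_avoid2 (k l : 'I_N) : k != l -> (2 <= N)%N ->
  \sum_(A : {set 'I_N}) unif_draw A * ((k \notin A)%:R * (l \notin A)%:R)
  = (N%:R - M%:R) * (N%:R - 1 - M%:R) / (N%:R * (N%:R - 1)).
Proof.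
move=> kl N2.
have := unif_draw_avoid [set k; l]%SET; rewrite cards2 kl => e.
transitivity (\sum_(A : {set 'I_N}) unif_draw A * (A \subset ~: [set k; l]%SET)%:R).
  apply: eq_bigr => A _; rewrite -natrM mulnb; congr (_ * _%:R).
  by rewrite finset.subsetC finset.subUset !finset.sub1set !inE.
rewrite e; have N0 : (0 < N)%N by apply: leq_trans N2.
have h1 := mul_bin_down N M; have h2 := mul_bin_down N.-1 M.
have C0 : 'C(N, M)%:R != 0 :> R by rewrite pnatr_eq0 -lt0n bin_gt0.
have Nn : N%:R != 0 :> R by rewrite pnatr_eq0 -lt0n.
have Nn1 : N%:R - 1 != 0 :> R by rewrite subr_eq0 pnatr_eq1 gtn_eqF.
have n1 : N.-1%:R = N%:R - 1 :> R by rewrite -[in RHS](prednK N0) -natr1 addrK.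
have -> : (N - true.+1 = N.-2)%N by rewrite subn2.
move: h1 => /(congr1 (fun n => n%:R : R)); rewrite !natrM natrB// => h1.
(* For [M = N] natural subtraction truncates, but then both binomials vanish. *)
have h2' : (N%:R - 1) * 'C(N.-2, M)%:R = (N%:R - 1 - M%:R) * 'C(N.-1, M)%:R :> R.
  have [MN1|] := leqP M N.-1.
    move: h2 => /(congr1 (fun n => n%:R : R)); by rewrite !natrM natrB// n1.
  move=> lt; rewrite !bin_small ?mulr0//.
  by apply: leq_ltn_trans lt; rewrite leq_pred.
apply/eqP; rewrite eqr_div ?mulf_neq0//; apply/eqP.
by rewrite [LHS]mulrC -mulrA h2' mulrCA h1; ring.
Qed.

Lemma unif_draw_mean (x : 'I_N -> R) : (0 < N)%N ->
  \sum_(A : {set 'I_N}) unif_draw A * (\sum_(k in A) x k)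
  = M%:R / N%:R * \sum_k x k.
Proof.
move=> N0; rewrite mulr_sumr.
under eq_bigr => A _ do rewrite big_mkcond /= mulr_sumr.
rewrite exchange_big /=; apply: eq_bigr => k _.
have <- : \sum_(A : {set 'I_N}) unif_draw A
    - \sum_(A : {set 'I_N}) unif_draw A * (k \notin A)%:R = M%:R / N%:R.
  by rewrite unif_draw_sum unif_draw_avoid1; field; rewrite pnatr_eq0 -lt0n.
rewrite -sumrB mulr_suml.
apply: eq_bigr => A _; case: ifP => kA; rewrite /=; ring.
Qed.

(* On centred values the sum over A is minus the sum over its complement, so
   that only the avoidance probabilities of one and of two clients matter. *)
Lemma unif_draw_var (x : 'I_N -> R) : (2 <= N)%N -> \sum_k x k = 0 ->
  \sum_(A : {set 'I_N}) unif_draw A * (\sum_(k in A) x k) ^+ 2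
  = M%:R * (N%:R - M%:R) / (N%:R * (N%:R - 1)) * \sum_k x k ^+ 2.
Proof.
move=> N2 x0; have N0 : (0 < N)%N by apply: leq_trans N2.
have Nn : N%:R != 0 :> R by rewrite pnatr_eq0 -lt0n.
have Nn1 : N%:R - 1 != 0 :> R by rewrite subr_eq0 pnatr_eq1 gtn_eqF.
(* [be] and [al] are the probabilities of avoiding two distinct clients and one client; [al - be] is
   the coefficient in the statement. *)
pose be : R := (N%:R - M%:R) * (N%:R - 1 - M%:R) / (N%:R * (N%:R - 1)).
pose al : R := (N%:R - M%:R) / N%:R.
have sq (A : {set 'I_N}) : (\sum_(k in A) x k) ^+ 2 =
    \sum_k \sum_l x k * x l * ((k \notin A)%:R * (l \notin A)%:R).
  have -> : \sum_(k in A) x k = - \sum_k x k * (k \notin A)%:R.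
    apply/eqP; rewrite -addr_eq0 big_mkcond /= -big_split /= -{}[X in _ == X]x0.
    by apply/eqP/eq_bigr => k _; case: (k \in A) => /=; ring.
  rewrite sqrrN expr2 mulr_suml; apply: eq_bigr => k _.
  by rewrite mulr_sumr; apply: eq_bigr => l _; ring.
under eq_bigr => A _ do rewrite sq mulr_sumr.
rewrite exchange_big /=.
transitivity (\sum_k \sum_l (x k * x l * be + (k == l)%:R * (x k * x l * (al - be)))).
  apply: eq_bigr => k _.
  under eq_bigr => A _ do rewrite mulr_sumr.
  rewrite exchange_big /=; apply: eq_bigr => l _.
  under eq_bigr => A _ do rewrite mulrCA.
  rewrite -mulr_sumr; have [->|kl] := eqVneq k l.
    under eq_bigr => A _ do rewrite -natrM mulnb andbb.
    by rewrite unif_draw_avoid1 -/al mul1r; ring.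
  by rewrite unif_draw_avoid2// -/be mul0r addr0.
rewrite (eq_bigr (fun k => \sum_l x k * x l * be +
    \sum_l (k == l)%:R * (x k * x l * (al - be)))) => [|k _]; last first.
  by rewrite big_split.
rewrite big_split /= [X in X + _]big1 ?add0r => [|k _]; last first.
  by rewrite -mulr_suml -mulr_sumr x0 mulr0 mul0r.
rewrite mulr_sumr; apply: eq_bigr => k _.
rewrite (bigD1 k)//= eqxx big1 ?addr0 => [|l /negbTE lk]; last first.
  by rewrite eq_sym lk mul0r.
by rewrite mul1r /al /be; field; rewrite Nn Nn1.
Qed.

End Clients.

(* [beta] has law [q] given the value of [Z], on the event [A]. *)
Lemma cond_avg (W B : finType) (V : Type) (mu : W -> R) (A : pred W) (Z : W -> V)
    (beta : W -> B) (q : B -> R) (phi : V -> B -> R) :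
  (forall v b, \sum_(w | A w && `[< Z w = v >] && (beta w == b)) mu w
     = q b * \sum_(w | A w && `[< Z w = v >]) mu w) ->
  \sum_(w | A w) mu w * phi (Z w) (beta w)
  = \sum_(w | A w) mu w * \sum_b q b * phi (Z w) b.
Proof.
move=> qP.
(* [V] need not be finite, so the fibres of [Z] are indexed by one chosen member each: the fixed
   points of [cls]. *)
pose cls (w : W) : W := odflt w [pick w' | `[< Z w' = Z w >]].
have clsZ w : Z (cls w) = Z w.
  by rewrite /cls; case: pickP => [w' /asboolP|].
have clsE w c : cls c = c -> (cls w == c) = `[< Z w = Z c >].
  move=> cc; apply/eqP/asboolP => [<-//|e]; rewrite -cc /cls.
  have -> : [pick w' | `[< Z w' = Z w >]] = [pick w' | `[< Z w' = Z c >]].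
    by apply: eq_pick => w'; rewrite e.
  by case: pickP => [//|/(_ c)]; rewrite asboolT.
have clsK w : cls (cls w) = cls w.
  rewrite {1}/cls; have -> : [pick w' | `[< Z w' = Z (cls w) >]] = [pick w' | `[< Z w' = Z w >]].
    by apply: eq_pick => w'; rewrite clsZ.
  rewrite /cls; case: pickP => //=.
have clsQ w : A w -> cls (cls w) == cls w by rewrite clsK.
rewrite (partition_big cls (fun c => cls c == c) clsQ).
rewrite [RHS](partition_big cls (fun c => cls c == c) clsQ) /=.
apply: eq_bigr => c /eqP cc.
transitivity (\sum_b \sum_(w | A w && `[< Z w = Z c >] && (beta w == b)) mu w * phi (Z c) b).
  rewrite (partition_big beta xpredT)//=; apply: eq_bigr => b _.
  apply: eq_big => [w|w]; first by rewrite clsE.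
  by move=> /andP[/andP[_ /eqP h] /eqP ->]; rewrite -h clsZ.
transitivity (\sum_b q b * (\sum_(w | A w && `[< Z w = Z c >]) mu w) * phi (Z c) b).
  by apply: eq_bigr => b _; rewrite -mulr_suml qP.
rewrite (eq_bigl (fun w => A w && `[< Z w = Z c >])) => [|w]; last by rewrite clsE.
rewrite [RHS](eq_bigr (fun w => mu w * \sum_b q b * phi (Z c) b)); last first.
  by move=> w /andP[_ /asboolP ->].
by rewrite -mulr_suml mulr_sumr; apply: eq_bigr => b _; ring.
Qed.

End Sampling.

(** * One round of local steps *)

Section Mean.
Context {R : realType} {W : finType} (mu : W -> R).

Definition mean (f : W -> R) : R := \sum_w mu w * f w.

Lemma eq_mean f g : f =1 g -> mean f = mean g.
Proof. by move=> fg; apply: eq_bigr => w _; rewrite fg. Qed.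

Lemma meanD f g : mean (fun w => f w + g w) = mean f + mean g.
Proof. by rewrite /mean -big_split /=; apply: eq_bigr => w _; rewrite mulrDr. Qed.

Lemma meanZ (a : R) f : mean (fun w => a * f w) = a * mean f.
Proof. by rewrite /mean mulr_sumr; apply: eq_bigr => w _; rewrite mulrCA. Qed.

Lemma meanN f : mean (fun w => - f w) = - mean f.
Proof. by rewrite /mean -sumrN; apply: eq_bigr => w _; rewrite mulrN. Qed.

Lemma mean_sum (I : Type) (r : seq I) (p : pred I) (f : I -> W -> R) :
  mean (fun w => \sum_(i <- r | p i) f i w) = \sum_(i <- r | p i) mean (f i).
Proof.
by rewrite /mean exchange_big /=; apply: eq_bigr => w _; rewrite mulr_sumr.
Qed.

Hypothesis mu0 : forall w, 0 <= mu w.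

(** Atoms of mass zero are exempt, because the almost sure assumptions are available only at
    representatives of positive mass. *)
Lemma mean_le f g : (forall w, 0 < mu w -> f w <= g w) -> mean f <= mean g.
Proof.
move=> fg; apply: ler_sum => w _.
have := mu0 w; rewrite le_eqVlt => /orP[/eqP <-|m0]; first by rewrite !mul0r.
by rewrite ler_wpM2l ?mu0// fg.
Qed.

Lemma mean_ge0 f : (forall w, 0 < mu w -> 0 <= f w) -> 0 <= mean f.
Proof.
move=> f0; apply: le_trans (mean_le f0).
by rewrite /mean big1// => w _; rewrite mulr0.
Qed.

Lemma mean_cst (a : R) : \sum_w mu w = 1 -> mean (fun=> a) = a.
Proof. by move=> mu1; rewrite /mean -mulr_suml mu1 mul1r. Qed.

End Mean.

Lemma sum_sqr_ord (R : realType) (K : nat) : (0 < K)%N ->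
  \sum_(s < K) (s%:R : R) ^+ 2 = (K%:R - 1) * K%:R * (2 * K%:R - 1) / 6.
Proof.
case: K => // K _; elim: K => [|K IH].
  by rewrite big_ord_recl big_ord0 /= expr0n addr0 subrr !mul0r.
by rewrite big_ord_recr /= IH -!natr1; field.
Qed.

(** * An abstract round: iterates [th], client gradients [a], minibatch errors [xi] *)

Section Round.
Context {R : realType} {d : nat} {W : finType}.
Variables (mu : W -> R) (N M K : nat) (eta Lw g z Sg : R).
Variables (S : W -> {set 'I_N}).
Variables (th a xi : 'I_N -> nat -> W -> 'rV[R]_d).
Hypotheses (mu0 : forall w, 0 <= mu w) (mu1 : \sum_w mu w = 1).
Hypotheses (M0 : (0 < M)%N) (K0 : (0 < K)%N).
Hypothesis cardS : forall w, 0 < mu w -> #|S w| = M.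
Hypothesis thS : forall w k s, (s < K)%N ->
  th k s.+1 w = th k s w - eta *: (a k s w + xi k s w).
Hypothesis lip : forall w k s, 0 < mu w -> k \in S w -> (s < K)%N ->
  nsq (a k s w - a k 0%N w) <= Lw ^+ 2 * nsq (th k s w - th k 0%N w).
Hypothesis cross_a : forall k s, (s < K)%N ->
  mean mu (fun w => (k \in S w)%:R * dot (a k s w) (xi k s w)) = 0.
Hypothesis cross_xi : forall k u s, (u < s)%N -> (s < K)%N ->
  mean mu (fun w => (k \in S w)%:R * dot (xi k u w) (xi k s w)) = 0.
Hypothesis var_xi : forall k s, (s < K)%N ->
  mean mu (fun w => (k \in S w)%:R * nsq (xi k s w)) <=
  Sg * mean mu (fun w => (k \in S w)%:R).
Hypotheses (eta0 : 0 <= eta) (Lw0 : 0 <= Lw) (etaK : eta * K%:R * Lw <= 4^-1).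
Hypotheses (g0 : 0 <= g) (z0 : 0 <= z) (Sg0 : 0 <= Sg).

Definition client_avg (f : 'I_N -> W -> R) w : R :=
  M%:R^-1 * \sum_(k in S w) f k w.

Hypothesis a_bound : mean mu (client_avg (fun k w => nsq (a k 0%N w))) <= g + z.

Let Mn0 : (M%:R : R) != 0. Proof. by rewrite pnatr_eq0 -lt0n. Qed.
Let Kn0 : (K%:R : R) != 0. Proof. by rewrite pnatr_eq0 -lt0n. Qed.
Let Gb : R := 2 * (g + 4 * (z + Sg)).
Let Gb0 : 0 <= Gb. Proof. by rewrite /Gb mulr_ge0// addr_ge0// mulr_ge0// addr_ge0. Qed.

Lemma mean_client_avg f : mean mu (client_avg f) =
  M%:R^-1 * \sum_k mean mu (fun w => (k \in S w)%:R * f k w).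
Proof.
rewrite meanZ -mean_sum; congr (_ * _); apply: eq_mean => w.
by rewrite big_mkcond; apply: eq_bigr => k _; case: (k \in S w); rewrite ?mul1r ?mul0r.
Qed.

Lemma client_avg_le f f' : (forall w k, 0 < mu w -> k \in S w -> f k w <= f' k w) ->
  mean mu (client_avg f) <= mean mu (client_avg f').
Proof.
move=> ff; apply: mean_le => // w w0; rewrite ler_wpM2l ?invr_ge0//.
by apply: ler_sum => k kS; apply: ff.
Qed.

Lemma client_avg_cst (b : R) : mean mu (client_avg (fun _ _ => b)) = b.
Proof.
rewrite -[RHS](mean_cst b mu1); apply: eq_bigr => w _.
have := mu0 w; rewrite le_eqVlt => /orP[/eqP <-|m0]; first by rewrite !mul0r.
by congr (_ * _); rewrite /client_avg sumr_const cardS// -(mulr_natl b) mulrA mulVf// mul1r.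
Qed.

Lemma client_avgD f f' : mean mu (client_avg (fun k w => f k w + f' k w)) =
  mean mu (client_avg f) + mean mu (client_avg f').
Proof.
rewrite -meanD; apply: eq_mean => w.
by rewrite /client_avg big_split /= mulrDr.
Qed.

Lemma client_avgZ (b : R) f : mean mu (client_avg (fun k w => b * f k w)) =
  b * mean mu (client_avg f).
Proof.
rewrite -meanZ; apply: eq_mean => w.
by rewrite /client_avg -mulr_sumr mulrCA.
Qed.

Lemma client_avg_sum (I : Type) (r : seq I) (f : I -> 'I_N -> W -> R) :
  mean mu (client_avg (fun k w => \sum_(i <- r) f i k w)) =
  \sum_(i <- r) mean mu (client_avg (f i)).
Proof.
rewrite -mean_sum; apply: eq_mean => w.
by rewrite /client_avg exchange_big /= mulr_sumr.
Qed.

Lemma nsq_client_avg (f : 'I_N -> W -> 'rV[R]_d) w : 0 < mu w ->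
  nsq (M%:R^-1 *: \sum_(k in S w) f k w) <= client_avg (fun k w => nsq (f k w)) w.
Proof.
move=> w0; rewrite /client_avg scaler_sumr mulr_sumr; apply: nsq_convex.
  by move=> k _; rewrite invr_ge0.
by rewrite sumr_const cardS// -(mulr_natl M%:R^-1) mulfV.
Qed.

Lemma var_client_avg s : (s < K)%N ->
  mean mu (client_avg (fun k w => nsq (xi k s w))) <= Sg.
Proof.
(* Writing 1 as the client average of 1 turns both sides into sums over clients weighted by the
   probability of being sampled. *)
move=> sK; rewrite -[leRHS]mulr1 -[X in _ * X](client_avg_cst 1) !mean_client_avg.
rewrite mulrCA ler_wpM2l ?invr_ge0// mulr_sumr; apply: ler_sum => k _.
apply: le_trans (var_xi k sK) _; rewrite ler_wpM2l//.
by rewrite le_eqVlt; apply/orP; left; apply/eqP/eq_mean => w; rewrite mulr1.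
Qed.

Lemma th_sum k s w : (s <= K)%N ->
  th k s w - th k 0%N w = - eta *: \sum_(u < s) (a k u w + xi k u w).
Proof.
elim: s => [|s IH] sK; first by rewrite big_ord0 subrr scaler0.
by rewrite thS// addrAC IH 1?ltnW// big_ord_recr /= [in RHS]scalerDr !scaleNr.
Qed.

(** [Gb] is the constant that closes the induction: by the bound at earlier steps, a direction has
    mean square at most [3/2 * (g + z) + 3 * (Gb / 16) + Sg], which is at most [Gb]. Summing [s]
    directions by Cauchy-Schwarz gives the factor [s^2]. *)
Lemma drift s : (s <= K)%N ->
  mean mu (client_avg (fun k w => nsq (th k s w - th k 0%N w)))
    <= s%:R ^+ 2 * eta ^+ 2 * Gb.
Proof.
elim/ltn_ind: s => s IH sK.
have step u : (u < s)%N ->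
    mean mu (client_avg (fun k w => nsq (a k u w + xi k u w))) <= Gb.
  move=> us; have uK := leq_trans us sK.
  have -> : mean mu (client_avg (fun k w => nsq (a k u w + xi k u w))) =
      mean mu (client_avg (fun k w => nsq (a k u w))) +
      mean mu (client_avg (fun k w => nsq (xi k u w))).
    rewrite -client_avgD !mean_client_avg; congr (_ * _); apply: eq_bigr => k _.
    rewrite -[RHS]addr0 -(mulr0 2) -(cross_a k uK) -meanZ -meanD.
    by apply: eq_mean => w; rewrite nsqD; ring.
  have h1 : mean mu (client_avg (fun k w => nsq (a k u w))) <=
      mean mu (client_avg (fun k w => 3 / 2 * nsq (a k 0%N w)
         + 3 * Lw ^+ 2 * nsq (th k u w - th k 0%N w))).
    apply: client_avg_le => w k w0 kS.
    (* Young with parameter 1/2, whence the factors 3/2 and 3. *)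
    have := nsqD_young (a k 0%N w) (a k u w - a k 0%N w) (a := 1/2) ltac:(lra).
    rewrite addrC subrK => /le_trans; apply.
    have := lip w0 kS uK.
    have -> : (1 / 2 : R)^-1 = 2 by field.
    lra.
  have h2 := var_client_avg uK.
  have h3 := IH u us (ltnW uK).
  (* The stepsize condition gives [Lw * u * eta <= 1/4]; 1/16 is its square. *)
  have u4 : Lw ^+ 2 * (u%:R ^+ 2 * eta ^+ 2) <= 16^-1.
    have : Lw * (u%:R * eta) <= 4^-1.
      apply: le_trans etaK; rewrite mulrC ler_wpM2r// mulrC ler_wpM2l//.
      by rewrite ler_nat ltnW.
    have : 0 <= Lw * (u%:R * eta) by rewrite !mulr_ge0.
    rewrite -!exprMn; move: (Lw * _) => t; nra.
  move: h1; rewrite client_avgD !client_avgZ => h1.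
  have h4 : Lw ^+ 2 * mean mu (client_avg (fun k w => nsq (th k u w - th k 0%N w)))
      <= 16^-1 * Gb.
    apply: le_trans (ler_wpM2l (sqr_ge0 Lw) h3) _.
    by rewrite mulrA ler_wpM2r.
  move: h1 h2 h4 a_bound; rewrite /Gb; move: g0 z0 Sg0; lra.
apply: (@le_trans _ _ (mean mu (client_avg (fun k w =>
    eta ^+ 2 * s%:R * \sum_(u < s) nsq (a k u w + xi k u w))))).
  apply: client_avg_le => w k _ _; rewrite th_sum// nsqZ sqrrN -mulrA.
  rewrite ler_wpM2l ?sqr_ge0//.
  have := nsq_sum xpredT (fun u : 'I_s => a k u w + xi k u w).
  by rewrite card_ord.
rewrite client_avgZ client_avg_sum.
have -> : s%:R ^+ 2 * eta ^+ 2 * Gb = eta ^+ 2 * s%:R * (\sum_(u < s) Gb).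
  by rewrite sumr_const card_ord -(mulr_natl Gb); ring.
rewrite ler_wpM2l ?mulr_ge0 ?sqr_ge0//.
by apply: ler_sum => u _; apply: step.
Qed.

Definition noise w : 'rV[R]_d :=
  M%:R^-1 *: \sum_(k in S w) K%:R^-1 *: \sum_(s < K) xi k s w.

Definition drift_bias w : 'rV[R]_d :=
  M%:R^-1 *: \sum_(k in S w) K%:R^-1 *: \sum_(s < K) (a k s w - a k 0%N w).

Definition sampled_grad w : 'rV[R]_d := M%:R^-1 *: \sum_(k in S w) a k 0%N w.

Lemma client_displacement w :
  M%:R^-1 *: \sum_(k in S w) (th k K w - th k 0%N w) =
  - (eta * K%:R) *: (noise w + drift_bias w + sampled_grad w).
Proof.
have -> : \sum_(k in S w) (th k K w - th k 0%N w) =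
   - (eta * K%:R) *: \sum_(k in S w) (K%:R^-1 *: (\sum_(s < K) xi k s w) +
     K%:R^-1 *: (\sum_(s < K) (a k s w - a k 0%N w)) + a k 0%N w).
  rewrite scaler_sumr; apply: eq_bigr => k _.
  have -> : K%:R^-1 *: (\sum_(s < K) xi k s w) +
      K%:R^-1 *: (\sum_(s < K) (a k s w - a k 0%N w)) + a k 0%N w =
      K%:R^-1 *: \sum_(s < K) (a k s w + xi k s w).
    rewrite sumrB sumr_const card_ord -[a k _ w *+ _]scaler_nat scalerBr scalerA mulVf//.
    by rewrite scale1r -addrA subrK big_split scalerDr addrC.
  by rewrite th_sum// scalerA mulNr mulfK.
by rewrite !big_split /= scalerA mulrC -scalerA !scalerDr.
Qed.

(** For one client the errors at different steps are orthogonal, so the average of [K] of them has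
    [K^-2] times a sum of [K] variances. *)
Lemma mean_nsq_noise : mean mu (fun w => nsq (noise w)) <= Sg / K%:R.
Proof.
have orth k n : (n <= K)%N ->
    mean mu (fun w => (k \in S w)%:R * nsq (\sum_(s < n) xi k s w)) =
    \sum_(s < n) mean mu (fun w => (k \in S w)%:R * nsq (xi k s w)).
  elim: n => [|n IH] nK.
    rewrite big_ord0 /mean big1// => w _.
    by rewrite big_ord0 nsq0 !mulr0.
  rewrite big_ord_recr /= -IH 1?ltnW// -[LHS]addr0.
  have c0 : mean mu (fun w => 2 * \sum_(s < n)
      ((k \in S w)%:R * dot (xi k s w) (xi k n w))) = 0.
    rewrite meanZ mean_sum big1 ?mulr0// => s _; exact: cross_xi.
  rewrite addr0 -[RHS]addr0 -c0 -!meanD; apply: eq_mean => w.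
  by rewrite big_ord_recr /= nsqD dot_suml -mulr_sumr; ring.
apply: (@le_trans _ _ (mean mu (client_avg (fun k w =>
    K%:R^-1 ^+ 2 * nsq (\sum_(s < K) xi k s w))))).
  apply: mean_le => // w w0; apply: le_trans (nsq_client_avg
    (fun k w => K%:R^-1 *: \sum_(s < K) xi k s w) w0) _.
  by rewrite /client_avg; under eq_bigr => k _ do rewrite nsqZ.
rewrite client_avgZ mean_client_avg.
under eq_bigr => k _ do rewrite orth//.
rewrite exchange_big /= mulr_sumr.
have -> : Sg / K%:R = K%:R^-1 ^+ 2 * \sum_(s < K) Sg.
  by rewrite sumr_const card_ord -(mulr_natr Sg); field.
rewrite ler_wpM2l ?sqr_ge0//; apply: ler_sum => s _.
by rewrite -mean_client_avg var_client_avg.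
Qed.

(** [Lw^2 * Gb * eta^2] times the average of [s^2] over [s < K], in closed form. *)
Definition drift_bound : R :=
  Lw ^+ 2 * Gb * eta ^+ 2 * (K%:R - 1) * (2 * K%:R - 1) / 6.

Lemma mean_nsq_drift : mean mu (fun w => nsq (drift_bias w)) <= drift_bound.
Proof.
apply: (@le_trans _ _ (mean mu (client_avg (fun k w =>
    K%:R^-1 * \sum_(s < K) Lw ^+ 2 * nsq (th k s w - th k 0%N w))))).
  apply: mean_le => // w w0; apply: le_trans (nsq_client_avg
    (fun k w => K%:R^-1 *: \sum_(s < K) (a k s w - a k 0%N w)) w0) _.
  rewrite /client_avg ler_wpM2l ?invr_ge0//; apply: ler_sum => k kS.
  apply: (@le_trans _ _ (\sum_(s < K) K%:R^-1 * nsq (a k s w - a k 0%N w))).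
    rewrite scaler_sumr; apply: nsq_convex => [s _|]; first by rewrite invr_ge0.
    by rewrite sumr_const card_ord -(mulr_natl K%:R^-1) mulfV.
  rewrite -mulr_sumr ler_wpM2l ?invr_ge0//; apply: ler_sum => s _.
  exact: lip.
rewrite client_avgZ client_avg_sum.
apply: (@le_trans _ _ (K%:R^-1 * \sum_(s < K) Lw ^+ 2 * (s%:R ^+ 2 * eta ^+ 2 * Gb))).
  rewrite ler_wpM2l ?invr_ge0//; apply: ler_sum => s _.
  by rewrite client_avgZ ler_wpM2l ?sqr_ge0// drift// ltnW.
rewrite -mulr_sumr -mulr_suml -mulr_suml sum_sqr_ord// /drift_bound.
by rewrite le_eqVlt; apply/orP; left; apply/eqP; field.
Qed.

Section Estimates.
Variables (G abar : W -> 'rV[R]_d) (H cm : R).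
Hypothesis cm0 : 0 < cm.
Hypothesis cross_G : forall k s, (s < K)%N ->
  mean mu (fun w => (k \in S w)%:R * dot (G w) (xi k s w)) = 0.
Hypothesis mean_G : mean mu (fun w => dot (G w) (sampled_grad w)) =
  mean mu (fun w => dot (G w) (abar w)).
Hypothesis sampling_var : mean mu (fun w => nsq (sampled_grad w - abar w)) <= H.

Definition round_dir w := noise w + drift_bias w + sampled_grad w.

(** The factor 3 comes from the three parts of the direction, the factor 6 from splitting the
    sampled gradient further around [abar]. *)
Lemma mean_nsq_round_dir : mean mu (fun w => nsq (round_dir w)) <=
  6 * mean mu (fun w => nsq (abar w)) + 3 * (Sg / K%:R) + 6 * H + 3 * drift_bound.
Proof.
have h1 := mean_nsq_noise; have h2 := mean_nsq_drift.
have : mean mu (fun w => nsq (round_dir w)) <=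
  mean mu (fun w => 3 * (nsq (noise w) + nsq (drift_bias w)
     + 2 * (nsq (abar w) + nsq (sampled_grad w - abar w)))).
  apply: mean_le => // w _; apply: le_trans (nsqD3 _ _ _) _.
  have := nsqD2 (abar w) (sampled_grad w - abar w); rewrite addrC subrK; lra.
by rewrite meanZ !meanD meanZ meanD; move: sampling_var; lra.
Qed.

(** Against [G] the minibatch noise has mean zero and the sampled gradient may be replaced by
    [abar]. Only the drift costs anything; Young with parameter [(3 * cm)^-1] makes its share of
    [nsq (G w)] equal to [(6 * cm)^-1]. *)
Lemma mean_dot_round_dir : - mean mu (fun w => dot (G w) (round_dir w)) <=
  - mean mu (fun w => dot (G w) (abar w)) + (6 * cm)^-1 * mean mu (fun w => nsq (G w))
  + 3 / 2 * cm * drift_bound.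
Proof.
have n0 : mean mu (fun w => dot (G w) (noise w)) = 0.
  transitivity (mean mu (client_avg (fun k w => K%:R^-1 * \sum_(s < K) dot (G w) (xi k s w)))).
    apply: eq_mean => w; rewrite /client_avg dotZr dot_sumr; congr (_ * _).
    by apply: eq_bigr => k _; rewrite dotZr dot_sumr.
  rewrite client_avgZ client_avg_sum big1 ?mulr0// => s _.
  by rewrite mean_client_avg big1 ?mulr0// => k _; apply: cross_G.
have -> : mean mu (fun w => dot (G w) (round_dir w)) =
  mean mu (fun w => dot (G w) (drift_bias w)) + mean mu (fun w => dot (G w) (abar w)).
  rewrite -mean_G -[RHS]add0r -n0 -!meanD; apply: eq_mean => w.
  by rewrite !dotDr addrA.
have : mean mu (fun w => - dot (G w) (drift_bias w)) <=
  mean mu (fun w => (6 * cm)^-1 * nsq (G w) + 3 / 2 * cm * nsq (drift_bias w)).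
  apply: mean_le => // w _; rewrite -dotNr.
  have c3 : 0 < (3 * cm)^-1 by rewrite invr_gt0 mulr_gt0.
  have := dot_young (G w) (- drift_bias w) c3; rewrite nsqN.
  have -> : (2 * (3 * cm)^-1)^-1 = 3 / 2 * cm by field; rewrite gt_eqF.
  have -> : (3 * cm)^-1 / 2 = (6 * cm)^-1 by field; rewrite gt_eqF.
  by [].
rewrite meanN meanD !meanZ.
have cm' : 0 <= 3 / 2 * cm by rewrite mulr_ge0// ltW.
have := ler_wpM2l cm' mean_nsq_drift.
lra.
Qed.

End Estimates.
End Round.

(** * Objectives, weights and the potential *)

Lemma mem_segment (R : realType) (d : nat) (u v : 'rV[R]_d) (a : R) :
  0 <= a <= 1 -> segment u v (u + a *: (v - u)).
Proof.
move=> a01; exists a; first by rewrite /= in_itv.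
by rewrite scalerBl scale1r scalerBr addrA addrAC.
Qed.

Lemma subsegment (R : realType) (d : nat) (u v : 'rV[R]_d) (a : R) :
  0 <= a <= 1 -> segment u (u + a *: (v - u)) `<=` segment u v.
Proof.
move=> /andP[a0 a1] w [b /= /[!in_itv]/= /andP[b0 b1]] <-.
have -> : (1 - b) *: u + b *: (u + a *: (v - u)) = u + (b * a) *: (v - u).
  by rewrite scalerDr scalerBl scale1r scalerA addrA subrK.
by apply: mem_segment; rewrite mulr_ge0//= mulr_ile1.
Qed.

Lemma maxr_lipschitz (R : realType) (x y z : R) :
  `|Num.max x z - Num.max y z| <= `|x - y|.
Proof.
have h1 := ler_norm (x - y); have := ler_norm (- (x - y)); rewrite normrN => h2.
by rewrite ler_norml; case: (leP x z) => xz; case: (leP y z) => yz; lra.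
Qed.

(* Dividing by the total weights costs the factor 2. *)
Lemma l1_dist_normalized_inv (R : realType) (m : nat) (x y : 'I_m -> R) (r e : R) :
  (0 < m)%N -> 0 < r ->
  (forall i, r <= x i) -> (forall i, r <= y i) -> (forall i, `|x i - y i| <= e) ->
  \sum_i `|(x i)^-1 / (\sum_j (x j)^-1) - (y i)^-1 / (\sum_j (y j)^-1)|
    <= 2 / r * e.
Proof.
move=> m0 r0 rx ry xy.
have x0 i : 0 < x i by apply: lt_le_trans (rx i).
have y0 i : 0 < y i by apply: lt_le_trans (ry i).
have x0' i : 0 <= x i := ltW (x0 i).
have y0' i : 0 <= y i := ltW (y0 i).
set A := \sum_j (x j)^-1; set B := \sum_j (y j)^-1.
have sum_pos (f : 'I_m -> R) : (forall i, 0 < f i) -> 0 < \sum_i f i.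
  move=> f0; rewrite (bigD1 (Ordinal m0))//= ltr_pwDl//.
  by apply: sumr_ge0 => i _; rewrite ltW.
have A0 : 0 < A by apply: sum_pos => i; rewrite invr_gt0.
have B0 : 0 < B by apply: sum_pos => i; rewrite invr_gt0.
have invx0 i : 0 <= (x i)^-1 by rewrite invr_ge0.
have AB1 : 0 < (A * B)^-1 by rewrite invr_gt0 mulr_gt0.
have B1 : 0 < B^-1 by rewrite invr_gt0.
(* The factor [(y i)^-1] is kept, so that summation over [i] produces [B]. *)
have dif i : `|(x i)^-1 - (y i)^-1| <= e / r * (y i)^-1.
  have -> : (x i)^-1 - (y i)^-1 = - (x i - y i) * ((x i)^-1 * (y i)^-1).
    by field; rewrite !gt_eqF.
  rewrite normrM normrN [X in _ * X]ger0_norm ?mulr_ge0 ?invr_ge0// mulrA.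
  rewrite ler_wpM2r ?invr_ge0// ler_pM ?invr_ge0//.
  by rewrite lef_pV2 ?posrE.
have S : \sum_i `|(x i)^-1 - (y i)^-1| <= e / r * B.
  by rewrite mulr_sumr; apply: ler_sum => i _.
have AB : `|B - A| <= e / r * B.
  apply: le_trans S; rewrite -sumrB; apply: le_trans (ler_norm_sum _ _ _) _.
  by apply: ler_sum => i _; rewrite distrC.
apply: (@le_trans _ _ (\sum_i ((x i)^-1 * (`|B - A| / (A * B))
    + `|(x i)^-1 - (y i)^-1| / B))).
  apply: ler_sum => i _.
  (* One part from the change of the total, one from the change of the numerator; each sums to at
     most [e / r]. *)
  have -> : (x i)^-1 / A - (y i)^-1 / B =
      (x i)^-1 * ((B - A) / (A * B)) + ((x i)^-1 - (y i)^-1) / B.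
    by field; rewrite !gt_eqF.
  apply: le_trans (ler_normD _ _) _; rewrite !normrM.
  by rewrite (ger0_norm (invx0 i)) (ger0_norm (ltW AB1)) (ger0_norm (ltW B1)).
rewrite big_split /= -mulr_suml -mulr_suml -/A.
have -> : A * (`|B - A| / (A * B)) = `|B - A| / B.
  by field; rewrite !gt_eqF.
rewrite -mulrDl ler_pdivrMr//.
have -> : 2 / r * e * B = e / r * B + e / r * B by field; rewrite gt_eqF.
exact: lerD.
Qed.

Section ObjectiveTheory.
Context {R : realType} {X : Type} {d N m nk b M K : nat}.
Variables (c : setup R X d N m nk b M K) (L : 'I_m -> R) (rho : R).
Hypotheses (N_ge2 : (2 <= N)%N) (m_ge1 : (1 <= m)%N) (nk_ge1 : (1 <= nk)%N)
  (b_ge1 : (1 <= b)%N).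
Hypothesis loss_diff :
  forall i x u, differentiable (fun v => loss c i v x) u.
Hypothesis obj_ge0 : forall k i u, 0 <= client_obj c k i u.
Hypothesis L_ge0 : forall i, 0 <= L i.
Hypothesis obj_smooth : forall k i u v,
  enorm (grad (client_obj c k i) u - grad (client_obj c k i) v)
    <= L i * enorm (u - v).
Hypotheses (rho_gt0 : 0 < rho) (rho_le : forall i, rho <= rref c i)
  (clip_itv : 0 < rclip c <= rho).

Let N0 : (0 < N)%N. Proof. exact: leq_trans N_ge2. Qed.

Let Nn0 : N%:R != 0 :> R. Proof. by rewrite pnatr_eq0 -lt0n. Qed.

Lemma client_objE k i : client_obj c k i =
  (fun u => \sum_(j < nk) nk%:R^-1 * loss c i u (example c k j)).
Proof. by apply/funext => u; rewrite /client_obj mulr_sumr. Qed.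

Lemma objE i : obj c i = (fun u => \sum_(k < N) N%:R^-1 * client_obj c k i u).
Proof. by apply/funext => u; rewrite /obj mulr_sumr. Qed.

Lemma differentiable_client_obj k i u : differentiable (client_obj c k i) u.
Proof. by rewrite client_objE; apply: differentiable_lincomb => j. Qed.

Lemma differentiable_obj i u : differentiable (obj c i) u.
Proof.
rewrite objE; apply: differentiable_lincomb => k.
exact: differentiable_client_obj.
Qed.

Lemma grad_client_obj k i u : grad (client_obj c k i) u =
  \sum_(j < nk) nk%:R^-1 *: grad (fun v => loss c i v (example c k j)) u.
Proof. by rewrite client_objE grad_lincomb. Qed.

Lemma grad_obj i u :
  grad (obj c i) u = \sum_(k < N) N%:R^-1 *: grad (client_obj c k i) u.
Proof. by rewrite objE grad_lincomb// => k; apply: differentiable_client_obj. Qed.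

Lemma obj_nonneg i u : 0 <= obj c i u.
Proof. by rewrite /obj mulr_ge0 ?invr_ge0// sumr_ge0. Qed.

Lemma client_obj_smooth k i u v :
  nsq (grad (client_obj c k i) u - grad (client_obj c k i) v)
    <= L i ^+ 2 * nsq (u - v).
Proof.
by rewrite -!enorm_sqr -exprMn ler_sqr ?nnegrE ?enorm_ge0 ?mulr_ge0 ?enorm_ge0.
Qed.

Lemma grad_obj_smooth i u v :
  enorm (grad (obj c i) u - grad (obj c i) v) <= L i * enorm (u - v).
Proof.
rewrite enorm_leP ?mulr_ge0 ?enorm_ge0// exprMn enorm_sqr !grad_obj -sumrB.
under eq_bigr => k _ do rewrite -scalerBr.
apply: (@le_trans _ _ (\sum_(k < N) N%:R^-1 *
    nsq (grad (client_obj c k i) u - grad (client_obj c k i) v))).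
  apply: nsq_convex => [k _|]; first by rewrite invr_ge0.
  by rewrite sumr_const card_ord -(mulr_natl N%:R^-1) mulfV.
apply: (@le_trans _ _ (\sum_(k < N) N%:R^-1 * (L i ^+ 2 * nsq (u - v)))).
  apply: ler_sum => k _; rewrite ler_wpM2l ?invr_ge0//.
  exact: client_obj_smooth.
by rewrite -mulr_sumr sumr_const card_ord -(mulr_natl (_ * _)) mulrA mulVf// mul1r.
Qed.

Definition Gmax : R := \big[Num.max/0]_i Num.sqrt (2 * L i * rref c i).

Lemma Gmax_ge0 : 0 <= Gmax.
Proof. exact: bigmax_ge_id. Qed.

Definition safe (u : 'rV[R]_d) := forall i, rho <= rref c i - obj c i u.

(** Self-bounding gives [2 * L i * obj c i u], and at a safe point the objective is below its
    reference; hence the form of [Gmax]. *)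
Lemma nsq_grad_obj i u : safe u -> nsq (grad (obj c i) u) <= Gmax ^+ 2.
Proof.
move=> su; have r0 : 0 <= rref c i by rewrite (le_trans _ (rho_le i))// ltW.
have q0 : 0 <= 2 * L i * rref c i by rewrite !mulr_ge0.
apply: (@le_trans _ _ (2 * L i * rref c i)).
  apply: (@le_trans _ _ (2 * L i * obj c i u)).
    apply: self_bounding => // v; [exact: differentiable_obj|exact: obj_nonneg|].
    move=> w; exact: grad_obj_smooth.
  rewrite ler_wpM2l ?mulr_ge0//.
  by have := su i; have := rho_gt0; lra.
rewrite -[leLHS]sqr_sqrtr// ler_sqr ?nnegrE ?sqrtr_ge0 ?Gmax_ge0//.
exact: le_bigmax.
Qed.

(** The mean value theorem. The whole segment has to be safe, since the gradient bound is taken at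
    an unspecified point of it. *)
Lemma obj_lipschitz i u v : (forall w, segment u v w -> safe w) ->
  (obj c i v - obj c i u) ^+ 2 <= Gmax ^+ 2 * nsq (v - u).
Proof.
move=> sw.
have [a a01] := @mvt_line _ _ (obj c i) u (v - u) (fun a _ => differentiable_obj i _).
have -> : u + (v - u) = v by rewrite addrC subrK.
move=> ->.
apply: le_trans (cauchy_schwarz _ _) _; rewrite ler_wpM2r ?nsq_ge0//.
by apply: nsq_grad_obj; apply: sw; apply: mem_segment.
Qed.

Lemma PhiE : Phi c = (fun u => \sum_i (-1) * ln (rref c i - obj c i u)).
Proof.
by apply/funext => u; rewrite /Phi -sumrN; apply: eq_bigr => i _; rewrite mulN1r.
Qed.

Lemma differentiable_gap i u : differentiable (fun v => rref c i - obj c i v) u.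
Proof.
have -> : (fun v => rref c i - obj c i v) = cst (rref c i) - obj c i.
  exact/funext.
by apply: differentiableB => //; apply: differentiable_obj.
Qed.

Lemma grad_gap i u : grad (fun v => rref c i - obj c i v) u = - grad (obj c i) u.
Proof.
have -> : (fun v => rref c i - obj c i v) = cst (rref c i) - obj c i.
  exact/funext.
apply/rowP => j; rewrite !mxE deriveB//; last first.
  by apply: diff_derivable; apply: differentiable_obj.
by rewrite derive_cst sub0r.
Qed.

Lemma gap_gt0 i u : safe u -> 0 < rref c i - obj c i u.
Proof. by move=> /(_ i); apply: lt_le_trans. Qed.

Lemma differentiable_Phi u : safe u -> differentiable (Phi c) u.
Proof.
move=> su; rewrite PhiE; apply: differentiable_lincomb => i.
by apply: differentiable_ln_comp; [exact: gap_gt0|exact: differentiable_gap].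
Qed.

Lemma grad_Phi u : safe u ->
  grad (Phi c) u = \sum_i (rref c i - obj c i u)^-1 *: grad (obj c i) u.
Proof.
move=> su; rewrite PhiE grad_lincomb => [|i]; last first.
  by apply: differentiable_ln_comp; [exact: gap_gt0|exact: differentiable_gap].
apply: eq_bigr => i _; rewrite grad_ln_comp; [|exact: gap_gt0|exact: differentiable_gap].
by rewrite grad_gap scalerN scaleN1r opprK.
Qed.

Lemma Phi_lower_bound u : safe u -> - \sum_i ln (rref c i) <= Phi c u.
Proof.
move=> su; rewrite lerN2; apply: ler_sum => i _.
have := gap_gt0 i su; have := obj_nonneg i u => o0 g0.
rewrite ler_ln ?posrE//; last by lra.
lra.
Qed.

Definition opt_weight u : 'I_m -> R := weights c (fun i => obj c i u).

Lemma clip_gt0 : 0 < rclip c. Proof. by case/andP: clip_itv. Qed.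

Lemma clip_inv_gt0 f i : 0 < (Num.max (rref c i - f i) (rclip c))^-1.
Proof. by rewrite invr_gt0 lt_max clip_gt0 orbT. Qed.

Lemma weights_sum_gt0 f : 0 < \sum_j (Num.max (rref c j - f j) (rclip c))^-1.
Proof.
rewrite (bigD1 (Ordinal m_ge1))//= ltr_pwDl ?clip_inv_gt0//.
by apply: sumr_ge0 => i _; rewrite ltW// clip_inv_gt0.
Qed.

Lemma weights_ge0 f i : 0 <= weights c f i.
Proof. by rewrite divr_ge0// ltW// ?clip_inv_gt0 ?weights_sum_gt0. Qed.

Lemma weights_sum1 f : \sum_i weights c f i = 1.
Proof. by rewrite -mulr_suml mulfV// gt_eqF// weights_sum_gt0. Qed.

Lemma l1_dist_weights f f' (e : R) : (forall i, `|f i - f' i| <= e) ->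
  \sum_i `|weights c f i - weights c f' i| <= 2 / rclip c * e.
Proof.
move=> fe; apply: l1_dist_normalized_inv => //; first exact: clip_gt0.
- by move=> i; rewrite le_max lexx orbT.
- by move=> i; rewrite le_max lexx orbT.
- move=> i; apply: le_trans (maxr_lipschitz _ _ _) _.
  rewrite (_ : _ - _ = - (f i - f' i)) ?normrN//; ring.
Qed.

Definition cmin : R := \sum_i (rref c i)^-1.
Definition cmax : R := m%:R / rho.
Definition wdist u (w : 'I_m -> R) : R := \sum_i `|w i - opt_weight u i|.
Definition wgrad u (w : 'I_m -> R) : 'rV[R]_d := \sum_i w i *: grad (obj c i) u.

Lemma cmax_gt0 : 0 < cmax.
Proof. by rewrite divr_gt0// ltr0n. Qed.

Lemma cmin_gt0 : 0 < cmin.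
Proof.
have r0 i : 0 < (rref c i)^-1 by rewrite invr_gt0 (lt_le_trans rho_gt0).
rewrite /cmin (bigD1 (Ordinal m_ge1))//= ltr_pwDl//.
by apply: sumr_ge0 => i _; rewrite ltW.
Qed.

Lemma nsq_wgradB u w : safe u ->
  nsq (wgrad u w - wgrad u (opt_weight u)) <= Gmax ^+ 2 * wdist u w ^+ 2.
Proof.
move=> su; rewrite /wgrad -sumrB.
under eq_bigr => i _ do rewrite -scalerBl.
apply: le_trans (nsq_wsum _ _ _) _; rewrite -/(wdist u w).
have w0 : 0 <= wdist u w by apply: sumr_ge0.
rewrite mulrC expr2 mulrA ler_wpM2r// mulrC mulr_suml.
by apply: ler_sum => i _; rewrite ler_wpM2l// nsq_grad_obj.
Qed.

Lemma nsq_wgrad u w : safe u -> (forall i, 0 <= w i) -> \sum_i w i = 1 ->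
  nsq (wgrad u w) <= Gmax ^+ 2.
Proof.
move=> su w0 w1; apply: (@le_trans _ _ (\sum_i w i * nsq (grad (obj c i) u))).
  by apply: nsq_convex => //; rewrite w1.
rewrite -[leRHS]mul1r -w1 mulr_suml; apply: ler_sum => i _.
by rewrite ler_wpM2l// nsq_grad_obj.
Qed.

(** Both vectors have total mass 1. This crude bound serves round 0, where the weights are
    uniform. *)
Lemma wdist_le2 u w : (forall i, 0 <= w i) -> \sum_i w i = 1 -> wdist u w <= 2.
Proof.
move=> w0 w1; apply: (@le_trans _ _ (\sum_i (w i + opt_weight u i))).
  apply: ler_sum => i _; apply: le_trans (ler_normB _ _) _.
  by rewrite !ger0_norm// weights_ge0.
by rewrite big_split /= w1 weights_sum1.
Qed.

Lemma grad_Phi_opt u : safe u -> exists2 cu : R, cmin <= cu <= cmax &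
  grad (Phi c) u = cu *: wgrad u (opt_weight u).
Proof.
move=> su; pose lam i := (rref c i - obj c i u)^-1.
have lam0 i : 0 < lam i by rewrite invr_gt0 gap_gt0.
(* Clipping is inactive at safe points, because [rclip c <= rho]. *)
have e i : (Num.max (rref c i - obj c i u) (rclip c))^-1 = lam i.
  rewrite max_l//; case/andP: clip_itv => _ h; apply: le_trans h (su i).
exists (\sum_i lam i).
  apply/andP; split.
    apply: ler_sum => i _; rewrite lef_pV2 ?posrE ?gap_gt0//.
      by rewrite gerBl obj_nonneg.
    exact: lt_le_trans (rho_le i).
  have -> : cmax = \sum_(i < m) rho^-1.
    by rewrite sumr_const card_ord -(mulr_natl rho^-1).
  by apply: ler_sum => i _; rewrite lef_pV2 ?posrE ?gap_gt0.
rewrite grad_Phi// /wgrad scaler_sumr; apply: eq_bigr => i _.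
rewrite scalerA /opt_weight /weights e -/(lam i); congr (_ *: _).
have eS : \sum_j (Num.max (rref c j - obj c j u) (rclip c))^-1 = \sum_j lam j.
  by apply: eq_bigr => j _; rewrite e.
have := weights_sum_gt0 (fun i => obj c i u); rewrite eS => S0.
by rewrite mulrCA mulfV ?mulr1// gt_eqF.
Qed.

(** Write [wgrad u w] as [cu^-1 *: G + D]. The first part gives [nsq G / cmax] at least; Young with
    parameter [(2 * cmax)^-1] gives up a quarter of it to control the weight error [D]. *)
Lemma dot_grad_Phi u w : safe u ->
  3 / (4 * cmax) * nsq (grad (Phi c) u) - cmax * (Gmax ^+ 2 * wdist u w ^+ 2)
    <= dot (grad (Phi c) u) (wgrad u w).
Proof.
move=> su; have [cu /andP[c1 c2] eG] := grad_Phi_opt su.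
have cu0 : 0 < cu := lt_le_trans cmin_gt0 c1.
set G := grad (Phi c) u in eG *; set D := wgrad u w - wgrad u (opt_weight u).
have -> : wgrad u w = cu^-1 *: G + D.
  by rewrite eG scalerA mulVf ?gt_eqF// scale1r addrC subrK.
rewrite dotDr dotZr -/(nsq G).
have cm0 := cmax_gt0.
have h1 : cmax^-1 * nsq G <= cu^-1 * nsq G.
  by rewrite ler_wpM2r ?nsq_ge0// lef_pV2 ?posrE.
have c4 : 0 < (2 * cmax)^-1 by rewrite invr_gt0 mulr_gt0.
have := dot_young G (- D) c4; rewrite nsqN dotNr.
have -> : (2 * (2 * cmax)^-1)^-1 = cmax by field; rewrite gt_eqF.
have -> : (2 * cmax)^-1 / 2 = 4^-1 * cmax^-1 by field; rewrite gt_eqF.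
have -> : 3 / (4 * cmax) = 3 / 4 * cmax^-1 by field; rewrite gt_eqF.
have := ler_wpM2l (ltW cm0) (nsq_wgradB w su); rewrite -/D.
move: h1; move: (cu^-1 * nsq G) => y.
rewrite -[3 / 4 * _ * _]mulrA -[4^-1 * _ * _]mulrA; lra.
Qed.

(** Returns the second-order term to [nsq (grad (Phi c) u)], where the stepsize condition can absorb
    it. The factor [cmin^-2] comes from [cu >= cmin]. *)
Lemma nsq_wgrad_le u w : safe u -> nsq (wgrad u w) <=
  2 / cmin ^+ 2 * nsq (grad (Phi c) u) + 2 * (Gmax ^+ 2 * wdist u w ^+ 2).
Proof.
move=> su; have [cu /andP[c1 c2] eG] := grad_Phi_opt su.
have cu0 : 0 < cu := lt_le_trans cmin_gt0 c1.
have := nsqD2 (wgrad u (opt_weight u)) (wgrad u w - wgrad u (opt_weight u)).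
rewrite addrC subrK; have := nsq_wgradB w su.
have : nsq (wgrad u (opt_weight u)) <= (cmin ^+ 2)^-1 * nsq (grad (Phi c) u).
  rewrite eG nsqZ mulrA ler_peMl ?nsq_ge0//.
  rewrite mulrC ler_pdivlMr ?exprn_gt0 ?cmin_gt0// mul1r.
  by rewrite ler_sqr ?nnegrE ?(ltW cu0) ?(ltW cmin_gt0).
rewrite -[2 / _ * _]mulrA; lra.
Qed.

(** Smoothness of [Phi] is available only between the ends of safe segments; hence the hypothesis on
    initial pieces of the segment. *)
Lemma Phi_descent (LPhi : R) u v : 0 <= LPhi ->
  (forall w, segment u v w -> safe w) ->
  (forall w, segment u w `<=` segment u v ->
     enorm (grad (Phi c) u - grad (Phi c) w) <= LPhi * enorm (u - w)) ->
  Phi c v <= Phi c u + dot (grad (Phi c) u) (v - u) + LPhi / 2 * nsq (v - u).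
Proof.
move=> LP sw sm.
have {1}-> : v = u + (v - u) by rewrite addrC subrK.
apply: smooth_upper_bound => a a01.
  by apply: differentiable_Phi; apply: sw; apply: mem_segment.
have eN (x y : 'rV[R]_d) : enorm (x - y) = enorm (y - x).
  by rewrite /enorm -!nsqE -nsqN opprB.
have := sm (u + a *: (v - u)) (subsegment a01).
by rewrite eN => /le_trans; apply; rewrite eN [u + _]addrC addrK.
Qed.

Lemma batch_grad_mean k i u (h : 'rV[R]_d) :
  \sum_(B : {ffun 'I_b -> 'I_nk}) (nk%:R ^+ b)^-1 * dot h (batch_grad c k i u B)
  = dot h (grad (client_obj c k i) u).
Proof.
pose f j := dot h (grad (fun v => loss c i v (example c k j)) u).
transitivity (nk%:R^-1 * \sum_j f j).
  rewrite -(minibatch_mean f nk_ge1 b_ge1); apply: eq_bigr => B _.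
  by rewrite /batch_grad dotZr dot_sumr.
rewrite grad_client_obj dot_sumr mulr_sumr; apply: eq_bigr => j _.
by rewrite dotZr.
Qed.

Lemma local_iter_ext k u w B B' s :
  (forall r, (r < s)%N -> B r = B' r) ->
  local_iter c k u w B s = local_iter c k u w B' s.
Proof.
elim: s => [//|s IH] BB /=.
by rewrite (IH (fun r rs => BB r (ltnW rs))) (BB s (ltnSn s)).
Qed.

End ObjectiveTheory.

(** * Reduction to finitely many histories *)

Section SigmaAlgebra.
Context {Om : Type} (G : set (set Om)).
Hypothesis sG : sigma_algebra setT G.

Lemma sigma_algebra_setT : G setT.
Proof. by case: sG => G0 GC _; rewrite -(setD0 setT); apply: GC. Qed.

Lemma sigma_algebra_setI A B : G A -> G B -> G (A `&` B).
Proof.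
have [//|+ _] := @sigma_algebraP _ setT G.
by move=> /(_ sG)[_ _ _]; apply.
Qed.

Lemma sigma_algebra_fin_forall (I : finType) (A : I -> set Om) :
  (forall i, G (A i)) -> G [set x | forall i, A i x].
Proof.
move=> GA.
suff h (s : seq I) : G [set x | forall i, i \in s -> A i x].
  have -> : [set x | forall i, A i x] = [set x | forall i, i \in enum I -> A i x].
    by apply/seteqP; split=> x /= h' i; [move=> _|]; apply: h'; rewrite ?mem_enum.
  exact: h.
elim: s => [|i s IH].
  have -> : [set x | forall i, i \in [::] -> A i x] = setT by apply/seteqP; split.
  exact: sigma_algebra_setT.
have -> : [set x | forall j, j \in i :: s -> A j x] =
  A i `&` [set x | forall j, j \in s -> A j x].
  apply/seteqP; split => x /= h.
    by split=> [|j js]; apply: h; rewrite inE ?eqxx ?js ?orbT.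
  by case: h => h1 h2 j; rewrite inE => /orP[/eqP ->|/h2].
exact: sigma_algebra_setI.
Qed.

End SigmaAlgebra.

(** * Conditional laws integrated over an event *)

Section Conditional.
Context {R : realType} {disp : measure_display} {Om : measurableType disp}.
Variables (P : probability Om R) (G : set (set Om)).

(** Integrate the version of the conditional probability over [C]: this event belongs to [G], and
    the version equals [p] almost everywhere on it. *)
Lemma cond_prob_onE (A E C : set Om) (p : R) :
  cond_prob_on P G A E p -> measurable E -> measurable C -> G C -> C `<=` A ->
  P (E `&` C) = (p%:E * P C)%E.
Proof.
move=> [Y [_ iY _ YE] Yp] mE mC GC CA.
rewrite -(integral_indic P mC mE) -YE//.
have -> : (\int[P]_(x in C) (Y x)%:E = \int[P]_(x in C) (cst p%:E) x)%E.
  apply: ae_eq_integral => //.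
    by case/integrableP: iY => mY _; apply: measurable_funS mY.
  by case: Yp => Z [mZ Z0 AZ]; exists Z; split=> // x /= h; apply: AZ => /= h';
    apply: h => /CA/h' ->.
by rewrite integral_cst.
Qed.

Lemma cond_exp_le (A C : set Om) (X Y : Om -> R) (v : R) :
  is_cond_exp P G X Y -> (\forall x \ae P, A x -> Y x <= v) -> 0 <= v ->
  measurable C -> G C -> C `<=` A ->
  (\int[P]_(x in C) (X x)%:E <= v%:E * P C)%E.
Proof.
move=> [_ iY _ YE] [Z [mZ Z0 AZ]] v0 mC GC CA.
(* [Y] is bounded only off the null set [Z], so the integral is first restricted to the complement
   of [Z]. *)
rewrite -YE// (negligible_integral mZ mC _ Z0); last first.
  exact: (integrableS measurableT mC (@subsetT _ _) iY).
have mCZ : measurable (C `\` Z) by exact: measurableD.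
apply: (@le_trans _ _ (\int[P]_(x in C `\` Z) (cst v%:E) x)%E).
  apply: le_integral.
  - exact: mCZ.
  - exact: (integrableS measurableT mCZ (@subsetT _ _) iY).
  - exact: finite_measure_integrable_cst.
  move=> x /set_mem[Cx nZx]; rewrite lee_fin.
  apply: contrapT => nY; apply: nZx; apply: AZ => /= AY; apply: nY.
  by apply: AY; apply: CA.
by rewrite integral_cst// lee_wpmul2l ?lee_fin// le_measure ?inE.
Qed.

End Conditional.

(** * Fibres of a finite-valued random variable *)

Section Atoms.
Context {R : realType} {disp : measure_display} {Om : measurableType disp}.
Variables (P : probability Om R) (W : finType) (h : Om -> W).
Hypothesis mh : forall w, measurable [set x | h x = w].

Definition atom_mass (w : W) : R := fine (P [set x | h x = w]).

Definition determined (V : Type) (f : Om -> V) :=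
  forall x y, h x = h y -> f x = f y.

Lemma atom_massE w : (atom_mass w)%:E = P [set x | h x = w].
Proof. by rewrite /atom_mass fineK// fin_num_measure. Qed.

Lemma atom_mass_ge0 w : 0 <= atom_mass w.
Proof. by rewrite -lee_fin atom_massE. Qed.

(** A fibre of positive mass cannot lie inside the exceptional null set. Over a null fibre the
    representative is an arbitrary point. *)
Lemma representative (good : Om -> Prop) : (\forall x \ae P, good x) ->
  exists rep : W -> Om, forall w, 0 < atom_mass w -> h (rep w) = w /\ good (rep w).
Proof.
move=> [Z [mZ Z0 gZ]].
suff pick w : exists x, 0 < atom_mass w -> h x = w /\ good x.
  by have [rep repP] := choice pick; exists rep.
have [w0|w0] := ltrP 0 (atom_mass w); last first.
  have [x _] : [set: Om] !=set0.
    apply/set0P/negP => /eqP T0; have := probability_setT P.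
    by rewrite T0 measure0 => /eqP; rewrite eqe eq_sym oner_eq0.
  by exists x.
apply: contrapT => /forallNP nex.
have sub : [set x | h x = w] `<=` Z.
  by move=> x /= hx; apply: gZ => /= gx; apply: (nex x).
have : (P [set x | h x = w] <= P Z)%E by apply: le_measure; rewrite ?inE.
by rewrite Z0 -atom_massE lee_fin leNgt w0.
Qed.

(** Such a set is a finite union of fibres. As the process depends on finitely many draws, this
    settles the measurability of its quantities. *)
Lemma measurable_determined (C : set Om) : determined C -> measurable C.
Proof.
move=> dC.
have -> : C = \big[setU/set0]_(w <- enum W) (C `&` [set x | h x = w]).
  rewrite -bigcup_seq; apply/seteqP; split => x.
    by move=> Cx; exists (h x) => //=; rewrite mem_enum.
  by case=> w _ [].
apply: bigsetU_measurable => w _.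
have [[x [Cx hx]]|n] := pselect (exists x, C x /\ h x = w).
  rewrite (_ : _ `&` _ = [set x | h x = w])//.
  apply/seteqP; split => [y []//|y /= hy]; split=> //.
  by rewrite (dC y x)// hx hy.
rewrite (_ : _ `&` _ = set0)//.
by apply/seteqP; split => // x [Cx hx]; case: n; exists x.
Qed.

Variable rep : W -> Om.
Hypothesis repP : forall w, 0 < atom_mass w -> h (rep w) = w.

Lemma integral_atoms (C : set Om) (f : Om -> R) :
  determined C -> determined f -> (forall x, 0 <= f x) ->
  (\int[P]_(x in C) (f x)%:E =
    (mean atom_mass (fun w => `[< C (rep w) >]%:R * f (rep w)))%:E)%E.
Proof.
move=> dC df f0.
have fib w : determined (C `&` [set x | h x = w]).
  by move=> x y xy; rewrite /setI/= (dC _ _ xy) xy.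
have eC : C = \big[setU/set0]_(w <- enum W) (C `&` [set x | h x = w]).
  rewrite -bigcup_seq; apply/seteqP; split => x.
    by move=> Cx; exists (h x) => //=; rewrite mem_enum.
  by case=> w _ [].
rewrite {1}eC ge0_integral_bigsetU//=; first last.
- by move=> x _; rewrite lee_fin.
- move=> mD Y mY; apply: measurable_determined.
  by rewrite -eC => x y xy; rewrite /setI/= (dC _ _ xy) /preimage /= (df _ _ xy).
- by move=> w w' _ _ [x [[_ hx] [_ hx']]]; rewrite -hx -hx'.
- exact: enum_uniq.
- by move=> w; apply: measurable_determined.
rewrite big_enum /= /mean -sumEFin; apply: eq_bigr => w _.
(* On a null fibre [rep w] says nothing about the integrand, so the integral is shown to vanish
   instead of being evaluated. *)
have := atom_mass_ge0 w; rewrite le_eqVlt => /orP[/eqP w0|w0].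
  rewrite -w0 mul0r; apply: null_set_integral.
  - exact: measurable_determined.
  - move=> mD Y mY; apply: measurable_determined.
    by move=> x y xy; rewrite /setI/= (dC _ _ xy) xy /preimage /= (df _ _ xy).
  - apply/eqP; rewrite eq_le measure_ge0 andbT.
    have -> : (0 = P [set x | h x = w])%E by rewrite -atom_massE -w0.
    apply: le_measure; rewrite ?inE//; first exact: measurable_determined.
have hr := repP w0; case: asboolP => Cr; last first.
  rewrite mul0r mulr0 (_ : _ `&` _ = set0) ?integral_set0//.
  apply/seteqP; split => // x [Cx hx]; apply: Cr.
  by rewrite (dC _ x)// hr hx.
rewrite mul1r (_ : _ `&` _ = [set x | h x = w]); last first.
  by apply/seteqP; split => [y []//|y /= hy]; split=> //; rewrite (dC _ (rep w))// hr.
rewrite (eq_integral (cst (f (rep w))%:E)) => [|x /set_mem /= hx]; last first.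
  by rewrite (df _ (rep w))// hr.
by rewrite integral_cst// EFinM atom_massE muleC.
Qed.

Lemma probability_atoms (C : set Om) : determined C ->
  P C = (\sum_(w | `[< C (rep w) >]) atom_mass w)%:E.
Proof.
move=> dC; have mC := measurable_determined dC.
have := integral_atoms (f := fun=> 1) dC (fun _ _ _ => erefl) (fun=> ler01).
rewrite (integral_cst P mC 1%:E) mul1e => ->.
congr (_%:E); rewrite /mean [RHS]big_mkcond; apply: eq_bigr => w _.
by case: ifP; rewrite !(mulr1, mulr0).
Qed.

Lemma atom_mass_sum1 : \sum_w atom_mass w = 1.
Proof.
have dT : determined [set: Om] by [].
apply/EFin_inj; rewrite -(probability_setT P) (probability_atoms dT).
by congr (_%:E); apply: eq_bigl => w; rewrite asboolT.
Qed.

Lemma expectation_atoms (f : Om -> R) : determined f -> (forall x, 0 <= f x) ->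
  ('E_P[f] = (mean atom_mass (f \o rep))%:E)%E.
Proof.
move=> df f0; rewrite unlock integral_atoms//; congr (_%:E).
by apply: eq_mean => w /=; rewrite asboolT// mul1r.
Qed.

End Atoms.

(** * Client gradients *)

Section VectorSampling.
Context {R : realType} {d N M : nat}.
Hypotheses (N_ge2 : (2 <= N)%N) (M_ge1 : (1 <= M)%N) (MN : (M <= N)%N).
Variable a : 'I_N -> 'rV[R]_d.

Let N0 : (0 < N)%N. Proof. exact: leq_trans N_ge2. Qed.
Let Nn0 : (N%:R : R) != 0. Proof. by rewrite pnatr_eq0 -lt0n. Qed.
Let Mn0 : (M%:R : R) != 0. Proof. by rewrite pnatr_eq0 -lt0n. Qed.
Let Nn1 : (N%:R - 1 : R) != 0. Proof. by rewrite subr_eq0 pnatr_eq1 gtn_eqF. Qed.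

Definition vmean : 'rV[R]_d := N%:R^-1 *: \sum_k a k.

Definition vvar : R := N%:R^-1 * \sum_k nsq (a k - vmean).

Lemma mean_nsq_decomp : N%:R^-1 * \sum_k nsq (a k) = nsq vmean + vvar.
Proof.
have e : \sum_k dot (a k) vmean = N%:R * nsq vmean.
  have s : \sum_k a k = N%:R *: vmean by rewrite /vmean scalerA mulfV// scale1r.
  by rewrite -dot_suml s dotZl.
have s : \sum_k nsq (a k - vmean) =
    \sum_k nsq (a k) - 2 * \sum_k dot (a k) vmean + \sum_(k < N) nsq vmean.
  by rewrite mulr_sumr -sumrB -big_split; apply: eq_bigr => k _; rewrite nsqB.
rewrite /vvar s e sumr_const card_ord -(mulr_natl (nsq vmean)).
by field.
Qed.

Lemma sampled_dot (h : 'rV[R]_d) :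
  \sum_(A : {set 'I_N}) unif_draw M A * dot h (M%:R^-1 *: \sum_(k in A) a k)
  = dot h vmean.
Proof.
under eq_bigr => A _ do rewrite dotZr dot_sumr mulrCA.
rewrite -mulr_sumr unif_draw_mean// /vmean dotZr dot_sumr.
by field; rewrite Nn0 Mn0.
Qed.

Lemma sampled_mean (x : 'I_N -> R) :
  \sum_(A : {set 'I_N}) unif_draw M A * (M%:R^-1 * \sum_(k in A) x k)
  = N%:R^-1 * \sum_k x k.
Proof.
under eq_bigr => A _ do rewrite mulrCA.
by rewrite -mulr_sumr unif_draw_mean//; field; rewrite Nn0 Mn0.
Qed.

(** Coordinate by coordinate this is the scalar variance on centred values; dividing by [M^2] and
    normalising by [N] leaves [chi N M]. *)
Lemma sampled_variance :
  \sum_(A : {set 'I_N}) unif_draw M A *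
     nsq (M%:R^-1 *: \sum_(k in A) (a k - vmean)) = chi N M * vvar.
Proof.
pose x j k := (a k - vmean) 0 j.
have x0 j : \sum_k x j k = 0.
  rewrite -summxE sumrB sumr_const card_ord -[vmean *+ N]scaler_nat /vmean.
  by rewrite scalerA mulfV// scale1r subrr mxE.
transitivity (\sum_j M%:R^-1 ^+ 2 * \sum_(A : {set 'I_N})
    unif_draw M A * (\sum_(k in A) x j k) ^+ 2).
  rewrite -mulr_sumr exchange_big mulr_sumr /=; apply: eq_bigr => A _.
  rewrite nsqZ nsqE -mulr_sumr mulrCA; congr (_ * (_ * _)).
  by apply: eq_bigr => j _; rewrite summxE.
under eq_bigr => j _ do rewrite unif_draw_var//.
rewrite -mulr_sumr -mulr_sumr /vvar.
have -> : \sum_k nsq (a k - vmean) = \sum_j \sum_k x j k ^+ 2.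
  by rewrite [RHS]exchange_big /=; apply: eq_bigr => k _; rewrite nsqE.
by rewrite /chi; field; rewrite Nn0 Mn0 Nn1.
Qed.

Lemma sampled_centred (A : {set 'I_N}) : #|A| = M ->
  M%:R^-1 *: \sum_(k in A) a k - vmean = M%:R^-1 *: \sum_(k in A) (a k - vmean).
Proof.
move=> cA; rewrite sumrB sumr_const cA -[vmean *+ M]scaler_nat scalerBr.
by rewrite [X in _ = _ - X]scalerA mulVf// scale1r.
Qed.

Lemma chi_ge0 : 0 <= chi N M :> R.
Proof.
have N1 : 0 <= N%:R - 1 :> R by rewrite subr_ge0 ler1n.
by rewrite /chi divr_ge0 ?mulr_ge0// subr_ge0 ler_nat.
Qed.

End VectorSampling.

(** * Weighted client gradients and their minibatch errors *)

Section ClientGradients.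
Context {R : realType} {X : Type} {d N m nk b M K : nat}.
Variables (c : setup R X d N m nk b M K) (L : 'I_m -> R).
Hypothesis loss_diff :
  forall i x u, differentiable (fun v => loss c i v x) u.
Hypothesis L_ge0 : forall i, 0 <= L i.
Hypothesis obj_smooth : forall k i u v,
  enorm (grad (client_obj c k i) u - grad (client_obj c k i) v)
    <= L i * enorm (u - v).
Variable w : 'I_m -> R.
Hypotheses (w_ge0 : forall i, 0 <= w i) (w_sum1 : \sum_i w i = 1).

Definition cgrad (k : 'I_N) (u : 'rV[R]_d) (w' : 'I_m -> R) : 'rV[R]_d :=
  \sum_i w' i *: grad (client_obj c k i) u.

Definition cnoise (k : 'I_N) (u : 'rV[R]_d) (w' : 'I_m -> R)
    (B : {ffun 'I_b -> 'I_nk}) : 'rV[R]_d :=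
  \sum_i w' i *: (batch_grad c k i u B - grad (client_obj c k i) u).

Lemma weight_le1 i : w i <= 1.
Proof.
rewrite -w_sum1 (bigD1 i)//= lerDl; apply: sumr_ge0 => j _; exact: w_ge0.
Qed.

Lemma wgrad_vmean u w' : wgrad c u w' = vmean (fun k => cgrad k u w').
Proof.
rewrite /vmean /cgrad exchange_big /= scaler_sumr; apply: eq_bigr => i _.
rewrite grad_obj// !scaler_sumr; apply: eq_bigr => k _.
by rewrite !scalerA mulrC.
Qed.

Lemma cgrad_smooth k u v :
  nsq (cgrad k u w - cgrad k v w) <= (\sum_i L i) ^+ 2 * nsq (u - v).
Proof.
rewrite /cgrad -sumrB; under eq_bigr => i _ do rewrite -scalerBr.
apply: (@le_trans _ _ (\sum_i w i *
    nsq (grad (client_obj c k i) u - grad (client_obj c k i) v))).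
  by apply: nsq_convex => //; rewrite w_sum1.
apply: (@le_trans _ _ (\sum_i w i * ((\sum_i L i) ^+ 2 * nsq (u - v)))); last first.
  by rewrite -mulr_suml w_sum1 mul1r.
apply: ler_sum => i _; rewrite ler_wpM2l//.
apply: le_trans (client_obj_smooth L_ge0 obj_smooth k i u v) _.
rewrite ler_wpM2r ?nsq_ge0// ler_sqr ?nnegrE ?sumr_ge0//.
by rewrite (bigD1 i)//= lerDl sumr_ge0.
Qed.

(** Convexity in the weights, then [w i <= 1]: this is how the unweighted sum [Sigma^2] arises. *)
Lemma nsq_cnoise k u B : nsq (cnoise k u w B) <=
  \sum_i nsq (batch_grad c k i u B - grad (client_obj c k i) u).
Proof.
apply: (@le_trans _ _ (\sum_i w i *
    nsq (batch_grad c k i u B - grad (client_obj c k i) u))).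
  by apply: nsq_convex => //; rewrite w_sum1.
by apply: ler_sum => i _; rewrite ler_piMl ?nsq_ge0 ?weight_le1.
Qed.

Lemma vvar_cgrad u (zeta : 'I_m -> R) :
  (forall i, heterogeneity c i u <= zeta i ^+ 2) ->
  vvar (fun k => cgrad k u w) <= \sum_i zeta i ^+ 2.
Proof.
move=> het; apply: (@le_trans _ _ (\sum_i w i * heterogeneity c i u)); last first.
  apply: ler_sum => i _; apply: le_trans (het i).
  rewrite ler_piMl ?weight_le1// /heterogeneity mulr_ge0 ?invr_ge0// sumr_ge0//.
  by move=> k _; rewrite sqr_ge0.
have -> : \sum_i w i * heterogeneity c i u = N%:R^-1 * \sum_(k < N) \sum_i
    w i * nsq (grad (client_obj c k i) u - grad (obj c i) u).
  rewrite exchange_big mulr_sumr; apply: eq_bigr => i _ /=.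
  rewrite /heterogeneity mulrCA mulr_sumr; congr (_ * _).
  by apply: eq_bigr => k _; rewrite enorm_sqr.
rewrite /vvar ler_wpM2l ?invr_ge0//; apply: ler_sum => k _.
rewrite -wgrad_vmean /cgrad /wgrad -sumrB.
under eq_bigr => i _ do rewrite -scalerBr.
by apply: nsq_convex => //; rewrite w_sum1.
Qed.

End ClientGradients.

(** * Scalar inequalities behind the constants *)

(** Here [ci] stands for [cm^-1]. The coefficients of [e * ci * g] add up to 3/4 - 1/6 - 1/8 =
    11/24, which is at least 1/4. *)
Lemma descent_arith (R : realType) (P0 P1 dt n a ci cm e l g w B r : R) :
  P1 <= P0 + dt + l / 2 * n ->
  dt <= e * (- a + 6^-1 * ci * g + 3 / 2 * cm * B) ->
  l / 2 * n <= e * (8^-1 * ci) * g + 6 * l * e ^+ 2 * w + l / 2 * e ^+ 2 * r ->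
  e * - a <= e * - (3 / 4 * ci * g - cm * w) -> 0 <= e * ci * g ->
  4^-1 * (e * ci) * g <= P0 - P1 + e * (cm + 6 * l * e) * w
    + (e * (3 / 2 * cm * B) + l / 2 * e ^+ 2 * r).
Proof. lra. Qed.

(** The first weight error has its own bound [d0], which occurs once and not [T] times. *)
Lemma telescope_arith (R : realType) (T : nat) (g phi Dw : nat -> R)
    (a e d0 d1 r lb : R) : (0 < T)%N ->
  (forall t, (t < T)%N -> a * g t <= phi t - phi t.+1 + e * Dw t + r) ->
  Dw 0%N <= d0 -> (forall t, (t.+1 < T)%N -> Dw t.+1 <= d1) ->
  0 <= e -> 0 <= d1 -> lb <= phi T ->
  a * \sum_(t < T) g t <= phi 0%N - lb + e * (d0 + T%:R * d1) + T%:R * r.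
Proof.
case: T => // T _ step D0 D1 e0 d1_ge0 lbT.
(* After the case split the horizon is [T.+1]: round 0 and [n] later rounds, whose final number is
   then rounded up. *)
suff h n : (n <= T)%N -> a * \sum_(t < n.+1) g t <=
    phi 0%N - phi n.+1 + e * (d0 + n%:R * d1) + n.+1%:R * r.
  apply: le_trans (h _ (leqnn T)) _; rewrite lerD2r.
  have : e * (d0 + T%:R * d1) <= e * (d0 + T.+1%:R * d1).
    by rewrite ler_wpM2l// lerD2l ler_wpM2r// ler_nat.
  by move: lbT; lra.
elim: n => [_|n IH nT].
  rewrite big_ord1 mul0r addr0 mul1r; apply: le_trans (step 0%N isT) _.
  by rewrite lerD2r lerD2l ler_wpM2l.
rewrite big_ord_recr /= mulrDr.
have h1 := IH (ltnW nT); have h2 := step n.+1 nT.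
have h3 := ler_wpM2l e0 (D1 n nT).
have -> : n.+1%:R = n%:R + 1 :> R by rewrite -natr1.
have -> : n.+2%:R = n.+1%:R + 1 :> R by rewrite -natr1.
have -> : e * (d0 + (n%:R + 1) * d1) = e * (d0 + n%:R * d1) + e * d1 by ring.
by rewrite mulrDl mul1r; lra.
Qed.

(** Multiply by [4 * cm / (eta * T)]. Then [eta <= etab] is used only inside the factors
    [cm + 6 * l * eta] and [cm + l * eta], and [SK <= S] replaces Sigma^2/K by Sigma^2 in the linear
    variance term. *)
Lemma rate_arith (R : realType) (T eta etab cm l Gm2 C2 X V S SK H B P0 lb sum : R) :
  0 < T -> 0 < eta -> eta <= etab -> 0 < cm -> 0 <= l -> 0 <= Gm2 -> 0 <= C2 ->
  0 <= X -> 0 <= V -> SK <= S -> 0 <= B ->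
  eta / (4 * cm) * sum <= P0 - lb
    + eta * (cm + 6 * l * eta) * (4 * Gm2 + T * (Gm2 * (C2 * (2 * X + 2 * Gm2 * (eta ^+ 2 * V)))))
    + T * (eta * (3 / 2 * cm * B) + l / 2 * eta ^+ 2 * (3 * SK + 6 * H + 3 * B)) ->
  T^-1 * sum <= 4 * cm * (P0 - lb) / (eta * T) + 6 * cm * l * eta * S
    + 12 * cm * l * eta * H + 6 * cm * (cm + l * etab) * B
    + 8 * cm * (cm + 6 * l * etab) * Gm2 * C2 * X
    + (8 * cm * (cm + 6 * l * etab) * Gm2 ^+ 2 * C2 * eta ^+ 2 * V
       + 16 * cm * (cm + 6 * l * etab) * Gm2 / T).
Proof.
move=> T0 eta0 etaE cm0 l0 G0 C0 X0 V0 SKS B0 h.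
have f0 : 0 <= 4 * cm / (eta * T) by rewrite divr_ge0 ?mulr_ge0 ?(ltW cm0) ?(ltW eta0) ?(ltW T0).
have -> : T^-1 * sum = 4 * cm / (eta * T) * (eta / (4 * cm) * sum).
  by field; rewrite !gt_eqF.
apply: le_trans (ler_wpM2l f0 h) _.
set Y := 2 * X + 2 * Gm2 * (eta ^+ 2 * V).
have -> : 4 * cm / (eta * T) * (P0 - lb + eta * (cm + 6 * l * eta) *
    (4 * Gm2 + T * (Gm2 * (C2 * Y)))
    + T * (eta * (3 / 2 * cm * B) + l / 2 * eta ^+ 2 * (3 * SK + 6 * H + 3 * B))) =
  4 * cm * (P0 - lb) / (eta * T)
  + (cm + 6 * l * eta) * (4 * cm * (4 * Gm2 / T + Gm2 * (C2 * Y)))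
  + 6 * cm * l * eta * SK + 12 * cm * l * eta * H + (cm + l * eta) * (6 * cm * B).
  by field; rewrite !gt_eqF.
have le : l * eta <= l * etab by rewrite ler_wpM2l.
have q0 : 0 <= 4 * cm * (4 * Gm2 / T + Gm2 * (C2 * Y)).
  by rewrite /Y !(mulr_ge0, addr_ge0)// ?invr_ge0 ?(ltW cm0) ?(ltW T0) ?(ltW eta0).
have le1 : (cm + 6 * l * eta) * (4 * cm * (4 * Gm2 / T + Gm2 * (C2 * Y))) <=
   (cm + 6 * l * etab) * (4 * cm * (4 * Gm2 / T + Gm2 * (C2 * Y))).
  by rewrite ler_wpM2r//; lra.
have le2 : 6 * cm * l * eta * SK <= 6 * cm * l * eta * S.
  by rewrite ler_wpM2l// !mulr_ge0// ltW.
have le3 : (cm + l * eta) * (6 * cm * B) <= (cm + l * etab) * (6 * cm * B).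
  by rewrite ler_wpM2r ?mulr_ge0 ?(ltW cm0)//; lra.
move: le1 le2 le3; rewrite /Y; lra.
Qed.

(** * The process *)

Section Process.
Context {R : realType} {X : Type} {d N m nk b M K : nat}.
Context {disp : measure_display} {Om : measurableType disp}.
Variables (P : probability Om R) (c : setup R X d N m nk b M K).
Variables (D : draws Om N nk b) (F : nat -> set (set Om)) (T : nat).
Variables (rho : R) (L zeta sigma : 'I_m -> R).

Hypotheses (N_ge2 : (2 <= N)%N) (m_ge1 : (1 <= m)%N) (nk_ge1 : (1 <= nk)%N)
  (b_ge1 : (1 <= b)%N) (K_ge1 : (1 <= K)%N) (M_ge1 : (1 <= M)%N) (MN : (M <= N)%N).
Hypothesis loss_diff :
  forall i x u, differentiable (fun v => loss c i v x) u.
Hypothesis obj_ge0 : forall k i u, 0 <= client_obj c k i u.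
Hypothesis L_ge0 : forall i, 0 <= L i.
Hypothesis obj_smooth : forall k i u v,
  enorm (grad (client_obj c k i) u - grad (client_obj c k i) v)
    <= L i * enorm (u - v).
Hypotheses (rho_gt0 : 0 < rho) (rho_le : forall i, rho <= rref c i)
  (clip_itv : 0 < rclip c <= rho).
Hypothesis clients_rv : forall t, (t < T)%N -> discrete_rv (clients D t).
Hypothesis reports_rv :
  forall t k, (t < T)%N -> discrete_rv (reports D t k).
Hypothesis batches_rv : forall t k s, (t < T)%N -> (s < K)%N ->
  discrete_rv (batches D t k s).
Hypothesis F_sigma : forall t, (t <= T)%N -> sigma_algebra setT (F t).
Hypothesis theta_adapted : forall t j, (t < T)%N ->
  measurable_wrt (F t) (fun x => theta c D t x 0 j).
Hypothesis weight_adapted : forall t i, (t < T)%N ->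
  measurable_wrt (F t) (fun x => weight c D t x i).
Hypothesis clients_unif : forall t (A : {set 'I_N}), (t < T)%N -> #|A| = M ->
  cond_prob_on P (F t) setT [set x | clients D t x = A] ('C(N, M)%:R^-1).
Hypothesis batches_unif : forall t k s (B : {ffun 'I_b -> 'I_nk}),
  (t < T)%N -> (s < K)%N ->
  cond_prob_on P (sigma_local D F t s) [set x | k \in clients D t x]
    [set x | batches D t k s x = B] ((nk%:R ^+ b)^-1).
Hypothesis grad_var : forall t k s i, (t < T)%N -> (s < K)%N ->
  exists2 Y : Om -> R,
    is_cond_exp P (sigma_local D F t s)
      (fun x => let u := local_theta c D t k s x in
         enorm (batch_grad c k i u (batches D t k s x)
                - grad (client_obj c k i) u) ^+ 2) Y &
    \forall x \ae P, k \in clients D t x -> Y x <= sigma i ^+ 2.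

Notation outcome := {ffun 'I_T -> {set 'I_N} * {ffun 'I_N -> {set 'I_nk}}
  * {ffun 'I_N -> {ffun 'I_K -> {ffun 'I_b -> 'I_nk}}}}.

(** Cutting rounds to ['I_T] and local steps to ['I_K] makes the type of outcomes finite. The draws
    of all clients are recorded, sampled or not. *)
Definition history (x : Om) : outcome :=
  [ffun t : 'I_T => (clients D t x, [ffun k => reports D t k x],
     [ffun k : 'I_N => [ffun s : 'I_K => batches D t k s x]])].

Lemma historyP x y : history x = history y -> forall t, (t < T)%N ->
  [/\ clients D t x = clients D t y, (forall k, reports D t k x = reports D t k y) &
      forall k s, (s < K)%N -> batches D t k s x = batches D t k s y].
Proof.
move=> /ffunP h t tT; have := h (Ordinal tT); rewrite !ffunE => -[-> h2 h3].
split=> // [k|k s sK].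
  by move: h2 => /ffunP/(_ k); rewrite !ffunE.
by move: h3 => /ffunP/(_ k)/[!ffunE]/ffunP/(_ (Ordinal sK)); rewrite !ffunE.
Qed.

Lemma measurable_history w : measurable [set x | history x = w].
Proof.
have sm := @sigma_algebra_measurable _ Om.
have -> : [set x | history x = w] = [set x | forall t : 'I_T,
   ([set x | clients D t x = (w t).1.1] `&`
   ([set x | forall k, [set x | reports D t k x = (w t).1.2 k] x] `&`
    [set x | forall k, [set x | forall s : 'I_K,
       [set x | batches D t k s x = (w t).2 k s] x] x])) x].
  apply/seteqP; split => x /=.
    move=> <- t; rewrite /history !ffunE /=; split=> //; split=> k; rewrite ffunE//.
    by move=> s; rewrite ffunE.
  move=> h; apply/ffunP => t; have [h1 [h2 h3]] := h t.
  rewrite ffunE h1 (surjective_pairing (w t)) (surjective_pairing (w t).1).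
  congr (_, _, _); apply/ffunP => k; rewrite ffunE ?h2//.
  by apply/ffunP => s; rewrite ffunE h3.
apply: (sigma_algebra_fin_forall sm) => t; apply: measurableI; first exact: clients_rv.
apply: measurableI; apply: (sigma_algebra_fin_forall sm) => k.
  exact: reports_rv.
by apply: (sigma_algebra_fin_forall sm) => s; apply: batches_rv.
Qed.

Lemma state_determined t x y : (t <= T)%N -> history x = history y ->
  state c D x t = state c D y t.
Proof.
move=> + h; elim: t => // t IH tT; rewrite /= IH 1?ltnW//.
case: (state c D y t) => u w; have [h1 h2 h3] := historyP h tT.
congr (_, _); last first.
  rewrite /server_report h1; congr weights; apply/funext => i.
  by congr (_ * _); apply: eq_bigr => k _; rewrite h2.
rewrite /server_step h1; congr (_ + _ *: (_ *: _)); apply: eq_bigr => k _.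
by congr (_ - _); apply: local_iter_ext => r rK; apply: h3.
Qed.

Lemma theta_determined t : (t <= T)%N -> determined history (theta c D t).
Proof. by move=> tT x y h; rewrite /theta (state_determined tT h). Qed.

Lemma weight_determined t : (t <= T)%N -> determined history (weight c D t).
Proof. by move=> tT x y h; rewrite /weight (state_determined tT h). Qed.

Lemma clients_determined t : (t < T)%N -> determined history (clients D t).
Proof. by move=> tT x y /historyP/(_ t tT)[]. Qed.

Lemma batches_determined t k s : (t < T)%N -> (s < K)%N ->
  determined history (batches D t k s).
Proof. by move=> tT sK x y /historyP/(_ t tT)[_ _]; apply. Qed.

Lemma local_theta_determined t k s : (t < T)%N -> (s <= K)%N ->
  determined history (local_theta c D t k s).
Proof.
move=> tT sK x y h; rewrite /local_theta (theta_determined (ltnW tT) h).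
rewrite (weight_determined (ltnW tT) h); apply: local_iter_ext => r rs.
by apply: batches_determined h => //; apply: leq_trans sK.
Qed.

Lemma report_error_determined t : (t < T)%N -> determined history (report_error c D t).
Proof.
move=> tT x y h; have [h1 h2 _] := historyP h tT.
rewrite /report_error /fhat (theta_determined (ltnW tT) h) h1.
apply: eq_bigr => i _; congr (`| _ - _ |); rewrite /server_report.
by congr (_ * _); apply: eq_bigr => k _; rewrite h2.
Qed.

Lemma weight_ge0 t x i : 0 <= weight c D t x i.
Proof.
rewrite /weight; case: t => [|t] /=; first by rewrite invr_ge0.
case: (state c D x t) => u w /=; exact: (weights_ge0 m_ge1 clip_itv).
Qed.

Lemma weight_sum1 t x : \sum_i weight c D t x i = 1.
Proof.
rewrite /weight; case: t => [|t] /=.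
  by rewrite sumr_const card_ord -(mulr_natl m%:R^-1) mulfV// pnatr_eq0 -lt0n.
case: (state c D x t) => u w /=; exact: (weights_sum1 m_ge1 clip_itv).
Qed.

Notation mu := (atom_mass P history).
Variable rep : outcome -> Om.
Hypothesis repP : forall w, 0 < mu w -> history (rep w) = w.

Let mh := measurable_history.

Let mu0 w : 0 <= mu w. Proof. exact: atom_mass_ge0. Qed.

Let mu1 : \sum_w mu w = 1. Proof. exact: (atom_mass_sum1 mh repP). Qed.

(** The form in which conditional laws are used: [C] has to be an event of the sub-sigma-field and
    at the same time a union of histories. *)
Lemma mass_conditional (G : set (set Om)) (A C E : set Om) (p : R) :
  cond_prob_on P G A E p -> G C -> C `<=` A ->
  determined history C -> determined history E ->
  \sum_(w | `[< C (rep w) >] && `[< E (rep w) >]) mu w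
  = p * \sum_(w | `[< C (rep w) >]) mu w.
Proof.
move=> pE GC CA dC dE.
have dEC : determined history (E `&` C).
  by move=> x y h; rewrite /setI/= (dC _ _ h) (dE _ _ h).
have := cond_prob_onE pE (measurable_determined mh dE) (measurable_determined mh dC) GC CA.
rewrite !(probability_atoms mh repP)// -EFinM => -[<-].
by apply: eq_bigl => w; rewrite andbC -asbool_and.
Qed.

(** * One round of the process under the atom masses *)

Section Round.
Variable t : nat.
Hypothesis tT : (t < T)%N.

Lemma state_event u w :
  F t [set x | theta c D t x = u /\ weight c D t x = w].
Proof.
have sF := F_sigma (ltnW tT).
rewrite (_ : [set x | _] =
  [set x | forall j, ((fun x => theta c D t x 0 j) @^-1` [set u 0 j]) x] `&`
  [set x | forall i, ((fun x => weight c D t x i) @^-1` [set w i]) x]); last first.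
  apply/seteqP; split => x /= [h1 h2]; split.
  - by move=> j; rewrite h1.
  - by move=> i; rewrite h2.
  - exact/rowP.
  - exact/funext.
apply: sigma_algebra_setI => //; apply: sigma_algebra_fin_forall => // j.
  exact: theta_adapted.
exact: weight_adapted.
Qed.

(** Each [M]-subset has mass ['C(N, M)%:R^-1], so together they exhaust the total mass 1 and nothing
    is left for other cardinalities. *)
Lemma card_clients w : 0 < mu w -> #|clients D t (rep w)| = M.
Proof.
move=> w0; apply/eqP/negPn/negP => nM.
have dcl A : determined history [set x | clients D t x = A].
  by move=> x y h; rewrite /= (clients_determined tT h).
pose ms (A : {set 'I_N}) := \sum_(w | `[< clients D t (rep w) = A >]) mu w.
have msE (A : {set 'I_N}) : #|A| = M -> ms A = 'C(N, M)%:R^-1.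
  rewrite /ms => AM; have dT : determined history [set: Om] by [].
  have := mass_conditional (clients_unif tT AM)
    (sigma_algebra_setT (F_sigma (ltnW tT))) (@subsetT _ _) dT (dcl A).
  rewrite (eq_bigl (fun w => `[< clients D t (rep w) = A >])) => [->|w']; last first.
    by rewrite asboolT.
  rewrite (eq_bigl xpredT) => [|w']; last by rewrite asboolT.
  by rewrite mu1 mulr1.
have ms1 : \sum_A ms A = 1.
  rewrite -mu1 (partition_big (fun w => clients D t (rep w)) xpredT)//=.
  apply: eq_bigr => A _; apply: eq_bigl => w'.
  by apply/asboolP/eqP.
have ge (A : {set 'I_N}) : unif_draw M A <= ms A.
  rewrite /unif_draw; case: eqP => [/msE ->//|_].
  exact: sumr_ge0.
have : \sum_(A : {set 'I_N}) (ms A - unif_draw M A) = 0.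
  by rewrite sumrB ms1 unif_draw_sum// subrr.
move/eqP; rewrite psumr_eq0 => [/allP|A _]; last by rewrite subr_ge0.
move=> /(_ (clients D t (rep w)) (mem_index_enum _)) /=.
rewrite /unif_draw (negbTE nM) subr0 /ms psumr_eq0// => /allP/(_ w (mem_index_enum _)).
by rewrite asboolT//= gt_eqF.
Qed.

Lemma clients_law (phi : 'rV[R]_d * ('I_m -> R) -> {set 'I_N} -> R) :
  mean mu (fun w => phi (state c D (rep w) t) (clients D t (rep w))) =
  mean mu (fun w => \sum_A unif_draw M A * phi (state c D (rep w) t) A).
Proof.
apply: (cond_avg (A := xpredT)) => -[u v] A /=.
have dC : determined history [set x | theta c D t x = u /\ weight c D t x = v].
  by move=> x y h; rewrite /= (theta_determined (ltnW tT) h)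
    (weight_determined (ltnW tT) h).
have eC x : (state c D x t = (u, v)) <-> (theta c D t x = u /\ weight c D t x = v).
  by rewrite /theta /weight; case: (state c D x t) => u' v' /=; split=> [[-> ->]|[-> ->]].
rewrite /unif_draw; case: eqP => AM.
  have dE : determined history [set x | clients D t x = A].
    by move=> x y h; rewrite /= (clients_determined tT h).
  have h := mass_conditional (clients_unif tT AM) (state_event u v) (@subsetT _ _) dC dE.
  apply: etrans (etrans _ h) _.
    apply: eq_bigl => w; congr (_ && _); first by apply/asboolP/asboolP => /= /eC.
    by apply/eqP/asboolP.
  by congr (_ * _); apply: eq_bigl => w; apply/asboolP/asboolP => /= /eC.
(* For sets of another size the law is 0, and by [card_clients] so are the masses. *)
rewrite mul0r big1// => w /andP[_ /eqP clA].
have := mu0 w; rewrite le_eqVlt => /orP[/eqP //|w0].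
by case: AM; rewrite -clA card_clients.
Qed.

Definition batch0 : {ffun 'I_b -> 'I_nk} := [ffun=> Ordinal nk_ge1].

(** The data that fix [theta_{k,s}]. Only the minibatches of client [k] enter, so that no joint law
    across clients is called for. *)
Definition past (k : 'I_N) (s : nat) (x : Om) :
    'rV[R]_d * ('I_m -> R) * {ffun 'I_s -> {ffun 'I_b -> 'I_nk}} :=
  (theta c D t x, weight c D t x, [ffun r : 'I_s => batches D t k r x]).

(** Indices [r >= s] get the default [batch0]; the first [s] local steps do not read them. *)
Definition past_batches s (z : {ffun 'I_s -> {ffun 'I_b -> 'I_nk}}) (r : nat) :=
  if insub r is Some i then z i else batch0.

Lemma past_batchesE k s x r : (r < s)%N ->
  past_batches (past k s x).2 r = batches D t k r x.
Proof. by move=> rs; rewrite /past_batches insubT /= ffunE. Qed.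

Lemma local_theta_past k s r x : (r <= s)%N ->
  local_theta c D t k r x =
  local_iter c k (past k s x).1.1 (past k s x).1.2 (past_batches (past k s x).2) r.
Proof.
move=> rs; apply: local_iter_ext => u ur.
by rewrite past_batchesE// (leq_trans ur).
Qed.

Lemma sampled_event s k : sigma_local D F t s [set x | k \in clients D t x].
Proof.
have sL := @smallest_sigma_algebra Om setT
  (F t `|` client_events D t `|` report_events D t `|` batch_events D t s).
(* The event is an intersection of complements of generators, over the sets [A] that miss [k]. *)
rewrite (_ : [set x | _] = [set x | forall A : {set 'I_N},
  (if k \in A then setT else setT `\` [set x | clients D t x = A]) x]); last first.
  apply/seteqP; split => x /= h.
    by move=> A; case: ifPn => // kA; split=> // e; move: kA; rewrite -e h.
  by have := h (clients D t x); case: ifPn => // _ [_ []].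
apply: (sigma_algebra_fin_forall sL) => A; case: ifP => _.
  exact: sigma_algebra_setT sL.
have [_ sC _] := sL; apply: sC; apply: sub_sigma_algebra.
by left; left; right; exists A.
Qed.

(** The generators reveal a minibatch only together with the fact that its client is sampled; hence
    the intersection with [k \in clients D t x]. *)
Lemma past_event k s v :
  sigma_local D F t s [set x | k \in clients D t x /\ past k s x = v].
Proof.
have sL := @smallest_sigma_algebra Om setT
  (F t `|` client_events D t `|` report_events D t `|` batch_events D t s).
case: v => [[u w] z].
rewrite (_ : [set x | _] =
  ([set x | k \in clients D t x] `&` [set x | theta c D t x = u /\ weight c D t x = w]) `&`
  [set x | forall r : 'I_s, [set x | k \in clients D t x /\ batches D t k r x = z r] x]);
    last first.
  apply/seteqP; split => x /=.
    by move=> [kS [<- <- <-]]; split=> // r; rewrite ffunE.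
  move=> [[kS [<- <-]] h]; split=> //; congr (_, _, _).
  by apply/ffunP => r; rewrite ffunE; have [] := h r.
apply: (sigma_algebra_setI sL).
  apply: (sigma_algebra_setI sL); first exact: sampled_event.
  by apply: sub_sigma_algebra; left; left; left; apply: state_event.
apply: (sigma_algebra_fin_forall sL) => r; apply: sub_sigma_algebra; right.
by exists k, r, (z r).
Qed.

Lemma mean_indicator (p : pred outcome) (f : outcome -> R) :
  mean mu (fun w => (p w)%:R * f w) = \sum_(w | p w) mu w * f w.
Proof.
rewrite [RHS]big_mkcond; apply: eq_bigr => w _.
by case: (p w); rewrite ?mul1r// mul0r mulr0.
Qed.

Lemma sampled_determined k : determined history [set x | k \in clients D t x].
Proof. by move=> x y h; rewrite /= (clients_determined tT h). Qed.

Lemma batches_law k s phi : (s < K)%N ->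
  mean mu (fun w => (k \in clients D t (rep w))%:R *
     phi (past k s (rep w)) (batches D t k s (rep w))) =
  mean mu (fun w => (k \in clients D t (rep w))%:R *
     \sum_B (nk%:R ^+ b)^-1 * phi (past k s (rep w)) B).
Proof.
move=> sK; rewrite !mean_indicator; apply: cond_avg => v B.
have dC : determined history [set x | k \in clients D t x /\ past k s x = v].
  move=> x y h; rewrite /= (clients_determined tT h) /past.
  rewrite (theta_determined (ltnW tT) h) (weight_determined (ltnW tT) h).
  rewrite (_ : [ffun r : 'I_s => batches D t k r x] = [ffun r : 'I_s => batches D t k r y])//.
  apply/ffunP => r; rewrite !ffunE; apply: batches_determined h => //.
  exact: ltn_trans (ltn_ord r) sK.
have dE : determined history [set x | batches D t k s x = B].
  by move=> x y h; rewrite /= (batches_determined k tT sK h).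
have CA : [set x | k \in clients D t x /\ past k s x = v] `<=`
    [set x | k \in clients D t x] by move=> x [].
have h := mass_conditional (batches_unif k B tT sK) (past_event k v) CA dC dE.
have eC w : (k \in clients D t (rep w)) && `[< past k s (rep w) = v >] =
    `[< [set x | k \in clients D t x /\ past k s x = v] (rep w) >].
  by apply/andP/asboolP => /= -[h1 h2]; split=> //; apply/asboolP.
apply: etrans (etrans _ h) _.
  by apply: eq_bigl => w; rewrite eC; congr (_ && _); apply/eqP/asboolP.
by congr (_ * _); apply: eq_bigl => w; rewrite eC.
Qed.

Lemma cnoise_mean k u w (h : 'rV[R]_d) :
  \sum_(B : {ffun 'I_b -> 'I_nk}) (nk%:R ^+ b)^-1 * dot h (cnoise c k u w B) = 0.
Proof.
transitivity (\sum_i w i * (\sum_(B : {ffun 'I_b -> 'I_nk}) (nk%:R ^+ b)^-1 *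
   dot h (batch_grad c k i u B) -
   (\sum_(B : {ffun 'I_b -> 'I_nk}) (nk%:R ^+ b)^-1) * dot h (grad (client_obj c k i) u))).
  under [RHS]eq_bigr => i _ do rewrite mulr_suml -sumrB mulr_sumr.
  rewrite [RHS]exchange_big /=; apply: eq_bigr => B _.
  rewrite /cnoise dot_sumr mulr_sumr; apply: eq_bigr => i _.
  by rewrite dotZr dotDr dotNr; ring.
apply: big1 => i _.
by rewrite batch_grad_mean// minibatch_weight// mul1r subrr mulr0.
Qed.

Definition iterate k s w := local_theta c D t k s (rep w).

Definition drift_grad k s w := cgrad c k (iterate k s w) (weight c D t (rep w)).

Definition grad_noise k s w :=
  cnoise c k (iterate k s w) (weight c D t (rep w)) (batches D t k s (rep w)).

(** The martingale difference property: given the past, the minibatch error has mean zero. The three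
    orthogonality relations of the abstract round are instances, with [H] the current client
    gradient, an earlier error, or the gradient of [Phi]. *)
Lemma noise_cross k s (H : _ -> 'rV[R]_d) : (s < K)%N ->
  mean mu (fun w => (k \in clients D t (rep w))%:R *
     dot (H (past k s (rep w))) (grad_noise k s w)) = 0.
Proof.
move=> sK.
pose phi v B := dot (H v) (cnoise c k (local_iter c k v.1.1 v.1.2 (past_batches v.2) s) v.1.2 B).
transitivity (mean mu (fun w => (k \in clients D t (rep w))%:R *
     phi (past k s (rep w)) (batches D t k s (rep w)))).
  by apply: eq_mean => w; rewrite /phi -local_theta_past.
rewrite batches_law// /mean big1// => w _.
by rewrite cnoise_mean !mulr0.
Qed.

Lemma mean_sampledE k : (mean mu (fun w => (k \in clients D t (rep w))%:R))%:E =
  P [set x | k \in clients D t x].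
Proof.
rewrite (probability_atoms mh repP (@sampled_determined k)); congr (_%:E).
rewrite /mean [RHS]big_mkcond; apply: eq_bigr => w _; rewrite /= asboolb.
by case: (_ \in _); rewrite ?mulr1 ?mulr0.
Qed.

Lemma grad_noise_var k s : (s < K)%N ->
  mean mu (fun w => (k \in clients D t (rep w))%:R * nsq (grad_noise k s w)) <=
  (\sum_i sigma i ^+ 2) * mean mu (fun w => (k \in clients D t (rep w))%:R).
Proof.
move=> sK.
pose e i x := enorm (batch_grad c k i (local_theta c D t k s x) (batches D t k s x)
                - grad (client_obj c k i) (local_theta c D t k s x)) ^+ 2.
have ei i : mean mu (fun w => (k \in clients D t (rep w))%:R * e i (rep w)) <=
   sigma i ^+ 2 * mean mu (fun w => (k \in clients D t (rep w))%:R).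
  have [Y YX Yle] := grad_var k i tT sK.
  have dS := @sampled_determined k.
  have := cond_exp_le YX Yle (sqr_ge0 _) (measurable_determined mh dS)
    (@sampled_event s k) (@subset_refl _ _).
  have de : determined history (e i).
    move=> x y h; rewrite /e (local_theta_determined k tT (ltnW sK) h).
    by rewrite (batches_determined k tT sK h).
  rewrite (integral_atoms mh repP dS de) => [|x]; last exact: sqr_ge0.
  rewrite -mean_sampledE -EFinM lee_fin; apply: le_trans.
  rewrite le_eqVlt; apply/orP; left; apply/eqP; apply: eq_mean => w.
  by congr (_%:R * _); rewrite /= asboolb.
apply: (@le_trans _ _ (mean mu (fun w =>
   \sum_i (k \in clients D t (rep w))%:R * e i (rep w)))).
  apply: mean_le => // w _; rewrite -mulr_sumr ler_wpM2l//.
  have h := nsq_cnoise c (weight_ge0 t (rep w)) (weight_sum1 t (rep w)) k.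
  apply: le_trans (h _ _) _.
  by apply: ler_sum => i _; rewrite /e enorm_sqr.
rewrite mean_sum mulr_suml; exact: ler_sum.
Qed.

Variables (Dom : set 'rV[R]_d) (LPhi : R).
Hypotheses (LPhi_gt0 : 0 < LPhi) (etal_gt0 : 0 < etal c) (etag_gt0 : 0 < etag c).
Hypothesis Phi_smooth : forall u v, segment u v `<=` safe_set c Dom rho ->
  enorm (grad (Phi c) u - grad (Phi c) v) <= LPhi * enorm (u - v).
Hypothesis safe_step : forall w, 0 < mu w ->
  segment (theta c D t (rep w)) (theta c D t.+1 (rep w)) `<=` safe_set c Dom rho.
Hypothesis het_theta : forall w i, 0 < mu w ->
  heterogeneity c i (theta c D t (rep w)) <= zeta i ^+ 2.
Hypothesis etal_le : etal c * K%:R * (\sum_i L i) <= 4^-1.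

Let Lw : R := \sum_i L i.
Let Sigma2 : R := \sum_i sigma i ^+ 2.
Let zeta2 : R := \sum_i zeta i ^+ 2.
Let Gm2 : R := Gmax c L ^+ 2.
Let HN : R := chi N M * zeta2.
Let eta_eff : R := etag c * etal c * K%:R.
Let B : R := drift_bound K (etal c) Lw Gm2 zeta2 Sigma2.

Lemma safe_theta w : 0 < mu w -> safe c rho (theta c D t (rep w)).
Proof.
move=> w0 i; have I0 : 0 <= (0 : R) <= 1 by rewrite lexx ler01.
have [_] := safe_step w0 (mem_segment _ _ I0).
by rewrite scale0r addr0; apply.
Qed.

Lemma safe_segment_theta w : 0 < mu w -> forall u,
  segment (theta c D t (rep w)) (theta c D t.+1 (rep w)) u -> safe c rho u.
Proof. by move=> w0 u /(safe_step w0)[]. Qed.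

Lemma safe_theta_next w : 0 < mu w -> safe c rho (theta c D t.+1 (rep w)).
Proof.
move=> w0 i; have I1 : 0 <= (1 : R) <= 1 by rewrite lexx ler01.
have [_] := safe_step w0 (mem_segment _ _ I1).
by rewrite scale1r addrC subrK; apply.
Qed.

Lemma iterate_step w k s : (s < K)%N -> iterate k s.+1 w =
  iterate k s w - etal c *: (drift_grad k s w + grad_noise k s w).
Proof.
move=> _; rewrite {1}/iterate /local_theta /=; congr (_ - _ *: _).
rewrite /drift_grad /grad_noise /cgrad /cnoise -big_split /=.
by apply: eq_bigr => i _; rewrite -scalerDr addrC subrK.
Qed.

Lemma drift_grad_lip w k s : 0 < mu w -> k \in clients D t (rep w) -> (s < K)%N ->
  nsq (drift_grad k s w - drift_grad k 0%N w) <=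
    Lw ^+ 2 * nsq (iterate k s w - iterate k 0%N w).
Proof.
move=> _ _ _.
exact: (cgrad_smooth L_ge0 obj_smooth (weight_ge0 t (rep w)) (weight_sum1 t (rep w))).
Qed.

Lemma drift_grad_past k s w : drift_grad k s w =
  cgrad c k (local_iter c k (past k s (rep w)).1.1 (past k s (rep w)).1.2
    (past_batches (past k s (rep w)).2) s) (past k s (rep w)).1.2.
Proof. exact: (f_equal (fun u => cgrad c k u _) (local_theta_past k _ (leqnn s))). Qed.

Lemma grad_noise_past k r s w : (r < s)%N -> grad_noise k r w =
  cnoise c k (local_iter c k (past k s (rep w)).1.1 (past k s (rep w)).1.2
    (past_batches (past k s (rep w)).2) r) (past k s (rep w)).1.2
    (past_batches (past k s (rep w)).2 r).
Proof.
move=> rs; exact: (f_equal2 (fun u => cnoise c k u _)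
  (local_theta_past k _ (ltnW rs)) (esym (past_batchesE k _ rs))).
Qed.

Lemma drift_grad_cross k s : (s < K)%N ->
  mean mu (fun w => (k \in clients D t (rep w))%:R *
     dot (drift_grad k s w) (grad_noise k s w)) = 0.
Proof.
move=> sK; apply: etrans (@noise_cross k s (fun v => cgrad c k
  (local_iter c k v.1.1 v.1.2 (past_batches v.2) s) v.1.2) sK).
by apply: eq_mean => w; rewrite drift_grad_past.
Qed.

Lemma grad_noise_cross k r s : (r < s)%N -> (s < K)%N ->
  mean mu (fun w => (k \in clients D t (rep w))%:R *
     dot (grad_noise k r w) (grad_noise k s w)) = 0.
Proof.
move=> rs sK; apply: etrans (@noise_cross k s (fun v => cnoise c k
  (local_iter c k v.1.1 v.1.2 (past_batches v.2) r) v.1.2 (past_batches v.2 r)) sK).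
by apply: eq_mean => w; rewrite (grad_noise_past k w rs).
Qed.

Definition grad_Phi_at w := grad (Phi c) (theta c D t (rep w)).

Definition avg_grad w := wgrad c (theta c D t (rep w)) (weight c D t (rep w)).

Lemma grad_Phi_cross k s : (s < K)%N ->
  mean mu (fun w => (k \in clients D t (rep w))%:R *
     dot (grad_Phi_at w) (grad_noise k s w)) = 0.
Proof.
by move=> sK; rewrite -(@noise_cross k s (fun v => grad (Phi c) v.1.1) sK).
Qed.

Notation sampled := (sampled_grad M (fun w => clients D t (rep w)) drift_grad).

Lemma sampled_grad_mean : mean mu (fun w => dot (grad_Phi_at w) (sampled w)) =
  mean mu (fun w => dot (grad_Phi_at w) (avg_grad w)).
Proof.
transitivity (mean mu (fun w => \sum_A unif_draw M A * dot (grad (Phi c) (state c D (rep w) t).1)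
   (M%:R^-1 *: \sum_(k in A) cgrad c k (state c D (rep w) t).1 (state c D (rep w) t).2))).
  rewrite -(clients_law (fun v A => dot (grad (Phi c) v.1)
    (M%:R^-1 *: \sum_(k in A) cgrad c k v.1 v.2))).
  exact: eq_mean.
apply: eq_mean => w; rewrite sampled_dot//.
by rewrite /avg_grad (wgrad_vmean loss_diff).
Qed.

Lemma sampled_grad_var :
  mean mu (fun w => nsq (sampled w - avg_grad w)) <= HN.
Proof.
pose a w k := cgrad c k (theta c D t (rep w)) (weight c D t (rep w)).
pose ph (v : 'rV[R]_d * ('I_m -> R)) (A : {set 'I_N}) :=
  nsq (M%:R^-1 *: \sum_(k in A) (cgrad c k v.1 v.2 - vmean (fun k => cgrad c k v.1 v.2))).
have -> : mean mu (fun w => nsq (sampled w - avg_grad w)) =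
   mean mu (fun w => ph (state c D (rep w) t) (clients D t (rep w))).
  apply: eq_bigr => w _.
  have := mu0 w; rewrite le_eqVlt => /orP[/eqP <-|w0]; first by rewrite !mul0r.
  congr (_ * _); rewrite /ph -sampled_centred ?card_clients//.
  by rewrite /avg_grad (wgrad_vmean loss_diff).
rewrite clients_law /ph.
rewrite -[leRHS](mean_cst _ mu1); apply: mean_le => // w w0.
rewrite sampled_variance// /HN ler_wpM2l ?chi_ge0//.
exact: (vvar_cgrad loss_diff (weight_ge0 t (rep w)) (weight_sum1 t (rep w))
  (fun i => het_theta i w0)).
Qed.

Lemma nsq_avg_grad w : 0 < mu w -> nsq (avg_grad w) <= Gm2.
Proof.
move=> w0; exact: (nsq_wgrad N_ge2 loss_diff obj_ge0 L_ge0 obj_smooth rho_gt0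
  rho_le (safe_theta w0) (weight_ge0 t (rep w)) (weight_sum1 t (rep w))).
Qed.

(** Averaging over the draw gives the population mean of squares, which splits into the squared
    mean, at most [Gm2], and the variance, at most [zeta2]. *)
Lemma drift_grad_bound :
  mean mu (client_avg M (fun w => clients D t (rep w))
    (fun k w => nsq (drift_grad k 0%N w))) <= Gm2 + zeta2.
Proof.
pose ph (v : 'rV[R]_d * ('I_m -> R)) (A : {set 'I_N}) :=
  M%:R^-1 * \sum_(k in A) nsq (cgrad c k v.1 v.2).
have -> : mean mu (client_avg M (fun w => clients D t (rep w))
    (fun k w => nsq (drift_grad k 0%N w))) =
  mean mu (fun w => ph (state c D (rep w) t) (clients D t (rep w))).
  exact: eq_mean.
rewrite clients_law /ph.
rewrite -[leRHS](mean_cst _ mu1); apply: mean_le => // w w0.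
rewrite sampled_mean// mean_nsq_decomp// -(wgrad_vmean loss_diff).
apply: lerD; first exact: nsq_avg_grad.
exact: (vvar_cgrad loss_diff (weight_ge0 t (rep w)) (weight_sum1 t (rep w))
  (fun i => het_theta i w0)).
Qed.

Let Lw0 : 0 <= Lw. Proof. exact: sumr_ge0. Qed.
Let z0 : 0 <= zeta2. Proof. by apply: sumr_ge0 => i _; rewrite sqr_ge0. Qed.
Let S0 : 0 <= Sigma2. Proof. by apply: sumr_ge0 => i _; rewrite sqr_ge0. Qed.
Let g0 : 0 <= Gm2. Proof. exact: sqr_ge0. Qed.

Notation dir := (round_dir M K (fun w => clients D t (rep w)) drift_grad grad_noise).

Lemma theta_step w : theta c D t.+1 (rep w) - theta c D t (rep w) =
  - eta_eff *: dir w.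
Proof.
have -> : theta c D t.+1 (rep w) - theta c D t (rep w) =
  etag c *: (M%:R^-1 *: \sum_(k in clients D t (rep w)) (iterate k K w - iterate k 0%N w)).
  rewrite /iterate /local_theta /weight /theta /=.
  by case: (state c D (rep w) t) => u v /=; rewrite /server_step addrC addKr.
rewrite (client_displacement M (fun w => clients D t (rep w)) K_ge1 iterate_step).
by rewrite scalerA mulrN mulrA.
Qed.

Let second_moment := mean_nsq_round_dir mu0 mu1 M_ge1 K_ge1 card_clients
  iterate_step drift_grad_lip drift_grad_cross grad_noise_cross grad_noise_var
  (ltW etal_gt0) Lw0 etal_le g0 z0 S0 drift_grad_bound sampled_grad_var.

Lemma mean_nsq_step :
  mean mu (fun w => nsq (theta c D t.+1 (rep w) - theta c D t (rep w))) <=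
  eta_eff ^+ 2 * (6 * mean mu (fun w => nsq (avg_grad w)) + 3 * (Sigma2 / K%:R)
     + 6 * HN + 3 * B).
Proof.
have -> : mean mu (fun w => nsq (theta c D t.+1 (rep w) - theta c D t (rep w))) =
    eta_eff ^+ 2 * mean mu (fun w => nsq (dir w)).
  by rewrite -meanZ; apply: eq_mean => w; rewrite theta_step nsqZ sqrrN.
by rewrite ler_wpM2l ?sqr_ge0// second_moment.
Qed.

Lemma mean_dot_step (cm : R) : 0 < cm ->
  mean mu (fun w => dot (grad_Phi_at w) (theta c D t.+1 (rep w) - theta c D t (rep w)))
  <= eta_eff * (- mean mu (fun w => dot (grad_Phi_at w) (avg_grad w))
     + (6 * cm)^-1 * mean mu (fun w => nsq (grad_Phi_at w)) + 3 / 2 * cm * B).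
Proof.
move=> cm0.
have -> : mean mu (fun w =>
    dot (grad_Phi_at w) (theta c D t.+1 (rep w) - theta c D t (rep w))) =
    eta_eff * - mean mu (fun w => dot (grad_Phi_at w) (dir w)).
  rewrite mulrN -mulNr -meanZ; apply: eq_mean => w.
  by rewrite theta_step dotZr.
rewrite ler_wpM2l ?mulr_ge0 ?(ltW etal_gt0) ?(ltW etag_gt0)//.
exact: (mean_dot_round_dir mu0 mu1 M_ge1 K_ge1 card_clients
  iterate_step drift_grad_lip drift_grad_cross grad_noise_var
  (ltW etal_gt0) Lw0 etal_le g0 z0 S0 drift_grad_bound cm0
  grad_Phi_cross sampled_grad_mean).
Qed.

(** The version free of gradients, which enters the weight error of the next round; its bracket
    becomes [V]. *)
Lemma mean_nsq_step_le :
  mean mu (fun w => nsq (theta c D t.+1 (rep w) - theta c D t (rep w))) <=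
  eta_eff ^+ 2 * (6 * Gm2 + 3 * (Sigma2 / K%:R) + 6 * HN + 3 * B).
Proof.
apply: le_trans mean_nsq_step _; rewrite ler_wpM2l ?sqr_ge0//.
have : mean mu (fun w => nsq (avg_grad w)) <= Gm2.
  rewrite -[leRHS](mean_cst _ mu1); apply: mean_le => // w; exact: nsq_avg_grad.
lra.
Qed.

Definition weight_error w := wdist c (theta c D t (rep w)) (weight c D t (rep w)) ^+ 2.

Lemma round_descent : eta_eff <= cmin c ^+ 2 / (48 * cmax (m := m) rho * LPhi) ->
  eta_eff / (4 * cmax (m := m) rho) * mean mu (fun w => nsq (grad_Phi_at w)) <=
  mean mu (fun w => Phi c (theta c D t (rep w)))
  - mean mu (fun w => Phi c (theta c D t.+1 (rep w)))
  + eta_eff * (cmax (m := m) rho + 6 * LPhi * eta_eff) *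
      (Gm2 * mean mu weight_error)
  + (eta_eff * (3 / 2 * cmax (m := m) rho * B)
     + LPhi / 2 * eta_eff ^+ 2 * (3 * (Sigma2 / K%:R) + 6 * HN + 3 * B)).
Proof.
set cm := cmax (m := m) rho => eta_le.
have cm0 : 0 < cm by apply: cmax_gt0.
have cn0 := cmin_gt0 m_ge1 rho_gt0 rho_le.
have eta0 : 0 < eta_eff by rewrite !mulr_gt0// ltr0n.
set g := mean mu (fun w => nsq (grad_Phi_at w)).
set Dw := Gm2 * mean mu weight_error.
have h1 : mean mu (fun w => Phi c (theta c D t.+1 (rep w))) <=
    mean mu (fun w => Phi c (theta c D t (rep w))) +
    mean mu (fun w => dot (grad_Phi_at w)
                  (theta c D t.+1 (rep w) - theta c D t (rep w))) +
    LPhi / 2 * mean mu (fun w => nsq (theta c D t.+1 (rep w) - theta c D t (rep w))).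
  rewrite -meanZ -!meanD; apply: mean_le => // w w0.
  apply: (Phi_descent loss_diff rho_gt0 (ltW LPhi_gt0) (safe_segment_theta w0)).
  move=> v sv; apply: Phi_smooth; exact: subset_trans sv (safe_step w0).
have h2 := mean_dot_step cm0.
have h3 := mean_nsq_step.
have h4 : 3 / (4 * cm) * g - cm * Dw <=
    mean mu (fun w => dot (grad_Phi_at w) (avg_grad w)).
  rewrite /g /Dw -meanZ -meanZ -meanZ -meanN -meanD; apply: mean_le => // w w0.
  exact: (dot_grad_Phi N_ge2 m_ge1 loss_diff obj_ge0 L_ge0 obj_smooth rho_gt0
    rho_le clip_itv _ (safe_theta w0)).
have h5 : mean mu (fun w => nsq (avg_grad w)) <= 2 / cmin c ^+ 2 * g + 2 * Dw.
  rewrite /g /Dw -meanZ -meanZ -meanZ -meanD; apply: mean_le => // w w0.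
  exact: (nsq_wgrad_le N_ge2 m_ge1 loss_diff obj_ge0 L_ge0 obj_smooth rho_gt0
    rho_le clip_itv _ (safe_theta w0)).
have g_ge0 : 0 <= g by apply: mean_ge0 => // w _; apply: nsq_ge0.
(* The stepsize condition in the form used: the second-order term carries
   [6 * LPhi * eta_eff / cmin^2], and 6/48 = 1/8. *)
have lin : LPhi * eta_eff / cmin c ^+ 2 <= (48 * cm)^-1.
  rewrite ler_pdivrMr ?exprn_gt0// mulrC -ler_pdivlMr//.
  apply: le_trans eta_le _; rewrite le_eqVlt; apply/orP; left; apply/eqP.
  by field; rewrite !gt_eqF.
set R0 := 3 * (Sigma2 / K%:R) + 6 * HN + 3 * B.
have h6 : LPhi / 2 * mean mu (fun w => nsq (theta c D t.+1 (rep w) - theta c D t (rep w)))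
    <= eta_eff * (8 * cm)^-1 * g + 6 * LPhi * eta_eff ^+ 2 * Dw +
       LPhi / 2 * eta_eff ^+ 2 * R0.
  have hL : 0 <= LPhi / 2 by rewrite divr_ge0// ltW.
  apply: le_trans (ler_wpM2l hL h3) _.
  have h7 : eta_eff ^+ 2 * (6 * mean mu (fun w => nsq (avg_grad w)) +
      3 * (Sigma2 / K%:R) + 6 * HN + 3 * B) <=
      eta_eff ^+ 2 * (6 * (2 / cmin c ^+ 2 * g + 2 * Dw) + R0).
    by rewrite ler_wpM2l ?sqr_ge0// /R0; lra.
  apply: le_trans (ler_wpM2l hL h7) _.
  have -> : LPhi / 2 * (eta_eff ^+ 2 * (6 * (2 / cmin c ^+ 2 * g + 2 * Dw) + R0)) =
    6 * eta_eff * g * (LPhi * eta_eff / cmin c ^+ 2) + 6 * LPhi * eta_eff ^+ 2 * Dw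
     + LPhi / 2 * eta_eff ^+ 2 * R0.
    by field; rewrite gt_eqF.
  rewrite !lerD2r.
  have -> : eta_eff * (8 * cm)^-1 * g = 6 * eta_eff * g * (48 * cm)^-1.
    by field; rewrite gt_eqF.
  by rewrite ler_wpM2l// !mulr_ge0// ltW.
have h8 : eta_eff * - mean mu (fun w => dot (grad_Phi_at w) (avg_grad w)) <=
    eta_eff * - (3 / (4 * cm) * g - cm * Dw).
  by rewrite ler_wpM2l ?(ltW eta0)// lerN2.
have e1 : (6 * cm)^-1 = 6^-1 * cm^-1 by rewrite invfM.
have e2 : (8 * cm)^-1 = 8^-1 * cm^-1 by rewrite invfM.
have e3 : 3 / (4 * cm) = 3 / 4 * cm^-1 by rewrite invfM mulrA.
have e4 : eta_eff / (4 * cm) = 4^-1 * (eta_eff * cm^-1) by rewrite invfM mulrCA.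
have p : 0 <= eta_eff * cm^-1 * g.
  by rewrite !mulr_ge0// ?invr_ge0 ltW.
rewrite e1 in h2; rewrite e2 in h6; rewrite e3 in h8; rewrite e4.
exact: (descent_arith h1 h2 h6 h8 p).
Qed.

End Round.

(** * Weight errors across rounds and the telescoped rate *)

Section Rate.
Variables (Dom : set 'rV[R]_d) (LPhi : R).
Hypotheses (LPhi_gt0 : 0 < LPhi) (etal_gt0 : 0 < etal c) (etag_gt0 : 0 < etag c).
Hypothesis Phi_smooth : forall u v, segment u v `<=` safe_set c Dom rho ->
  enorm (grad (Phi c) u - grad (Phi c) v) <= LPhi * enorm (u - v).
Hypothesis safe_steps : forall t w, (t < T)%N -> 0 < mu w ->
  segment (theta c D t (rep w)) (theta c D t.+1 (rep w)) `<=` safe_set c Dom rho.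
Hypothesis het_thetas : forall t w i, (t < T)%N -> 0 < mu w ->
  heterogeneity c i (theta c D t (rep w)) <= zeta i ^+ 2.
Hypothesis etal_le : etal c * K%:R * (\sum_i L i) <= 4^-1.
Hypothesis T_gt0 : (0 < T)%N.

Let Sigma2 : R := \sum_i sigma i ^+ 2.
Let zeta2 : R := \sum_i zeta i ^+ 2.
Let Gm2 : R := Gmax c L ^+ 2.
Let HN : R := chi N M * zeta2.
Let eta_eff : R := etag c * etal c * K%:R.
Let B : R := drift_bound K (etal c) (\sum_i L i) Gm2 zeta2 Sigma2.
Let cm : R := cmax (m := m) rho.
Let eta_bar : R := cmin c ^+ 2 / (48 * cm * LPhi).
Let C2 : R := (2 / rclip c) ^+ 2.
Let V : R := 6 * Gm2 + 3 * (Sigma2 / K%:R) + 6 * HN + 3 * B.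

Hypothesis eta_le : eta_eff <= eta_bar.

Lemma weight_error_init : mean mu (weight_error 0) <= 4.
Proof.
rewrite -[leRHS](mean_cst _ mu1); apply: mean_le => // w w0.
have h := wdist_le2 m_ge1 clip_itv (theta c D 0 (rep w)) (weight_ge0 0 (rep w))
  (weight_sum1 0 (rep w)).
have h0 : 0 <= wdist c (theta c D 0 (rep w)) (weight c D 0 (rep w)) by apply: sumr_ge0.
rewrite /weight_error (_ : 4 = 2 ^+ 2); last by rewrite -natrX.
by rewrite ler_sqr ?nnegrE.
Qed.

Lemma weight_error_step t : (t < T)%N ->
  mean mu (weight_error t.+1) <=
  C2 * (2 * mean mu (fun w => report_error c D t (rep w) ^+ 2) + 2 * Gm2 *
    mean mu (fun w => nsq (theta c D t.+1 (rep w) - theta c D t (rep w)))).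
Proof.
move=> tT; rewrite -meanZ -meanZ -meanD -meanZ; apply: mean_le => // w w0.
set x := rep w; set dt := theta c D t.+1 x - theta c D t x.
pose e := report_error c D t x + Gmax c L * enorm dt.
have e0 : 0 <= report_error c D t x by exact: bigmax_ge_id.
have G0 : 0 <= Gmax c L by exact: Gmax_ge0.
have wE : weight c D t.+1 x = weights c (fhat c D t x).
  rewrite /weight /fhat /theta /=.
  by case: (state c D x t) => u v /=.
have close : wdist c (theta c D t.+1 x) (weight c D t.+1 x) <= 2 / rclip c * e.
  rewrite /wdist wE; apply: (l1_dist_weights m_ge1 clip_itv) => i.
  have -> : fhat c D t x i - obj c i (theta c D t.+1 x) =
    (fhat c D t x i - obj c i (theta c D t x)) -
    (obj c i (theta c D t.+1 x) - obj c i (theta c D t x)) by ring.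
  apply: le_trans (ler_normB _ _) _; apply: lerD.
    exact: (le_bigmax (0 : R) (fun i => `|fhat c D t x i - obj c i (theta c D t x)|)).
  rewrite -(ler_pXn2r (n := 2))// ?nnegrE ?mulr_ge0 ?enorm_ge0//.
  rewrite real_normK ?num_real// exprMn enorm_sqr.
  apply: (obj_lipschitz N_ge2 loss_diff obj_ge0 L_ge0 obj_smooth rho_gt0 rho_le).
  by move=> u /(safe_steps tT w0)[].
have c0 : 0 < rclip c by case/andP: clip_itv.
have close0 : 0 <= wdist c (theta c D t.+1 x) (weight c D t.+1 x) by apply: sumr_ge0.
have ce : 0 <= 2 / rclip c * e.
  by rewrite mulr_ge0 ?divr_ge0 ?(ltW c0)// addr_ge0// mulr_ge0// enorm_ge0.
apply: (@le_trans _ _ ((2 / rclip c * e) ^+ 2)).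
  by rewrite /weight_error ler_sqr// nnegrE.
rewrite exprMn -/C2 ler_wpM2l ?sqr_ge0// /e -/dt -enorm_sqr /Gm2.
have := sqr_ge0 (report_error c D t x - Gmax c L * enorm dt).
move: (report_error c D t x) (Gmax c L) (enorm dt) => r g n.
by lra.
Qed.

Let drift_ge0 : 0 <= B.
Proof.
have z0 : 0 <= zeta2 by apply: sumr_ge0 => i _; rewrite sqr_ge0.
have S0 : 0 <= Sigma2 by apply: sumr_ge0 => i _; rewrite sqr_ge0.
have g0 : 0 <= Gm2 := sqr_ge0 _.
have K1 : 1 <= K%:R :> R by rewrite ler1n.
have K2 : 0 <= K%:R - 1 :> R by lra.
have K3 : 0 <= 2 * K%:R - 1 :> R by lra.
have b0 : 0 <= 2 * (Gm2 + 4 * (zeta2 + Sigma2)) by lra.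
apply: divr_ge0 => //.
exact: mulr_ge0 (mulr_ge0 (mulr_ge0 (mulr_ge0 (sqr_ge0 _) b0) (sqr_ge0 _)) K2) K3.
Qed.

Lemma gradient_rate (Xi : R) : 0 <= Xi ->
  (forall t, (t < T)%N -> mean mu (fun w => report_error c D t (rep w) ^+ 2) <= Xi) ->
  T%:R^-1 * \sum_(t < T) mean mu (fun w => nsq (grad_Phi_at t w)) <=
  4 * cm * (Phi c (theta0 c) - - \sum_i ln (rref c i)) / (eta_eff * T%:R)
  + 6 * cm * LPhi * eta_eff * Sigma2
  + 12 * cm * LPhi * eta_eff * HN + 6 * cm * (cm + LPhi * eta_bar) * B
  + 8 * cm * (cm + 6 * LPhi * eta_bar) * Gm2 * C2 * Xi
  + (8 * cm * (cm + 6 * LPhi * eta_bar) * Gm2 ^+ 2 * C2 * eta_eff ^+ 2 * V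
     + 16 * cm * (cm + 6 * LPhi * eta_bar) * Gm2 / T%:R).
Proof.
move=> Xi0 errX.
have cm0 : 0 < cm by apply: cmax_gt0.
have eta0 : 0 < eta_eff by rewrite !mulr_gt0// ltr0n.
have z0 : 0 <= zeta2 by apply: sumr_ge0 => i _; rewrite sqr_ge0.
have S0 : 0 <= Sigma2 by apply: sumr_ge0 => i _; rewrite sqr_ge0.
have g0 : 0 <= Gm2 := sqr_ge0 _.
have H0 : 0 <= HN by rewrite mulr_ge0// chi_ge0.
have SK : Sigma2 / K%:R <= Sigma2.
  by rewrite ler_pdivrMr ?ltr0n// ler_peMr// ler1n.
have SK0 : 0 <= Sigma2 / K%:R by rewrite divr_ge0.
have V0 : 0 <= V by rewrite /V; move: g0 SK0 H0 drift_ge0; lra.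
have C0 : 0 <= C2 := sqr_ge0 _.
have E0 : 0 <= eta_eff * (cm + 6 * LPhi * eta_eff).
  have l0 : 0 <= 6 * LPhi by rewrite mulr_ge0// ltW.
  exact: mulr_ge0 (ltW eta0) (addr_ge0 (ltW cm0) (mulr_ge0 l0 (ltW eta0))).
apply: (rate_arith (SK := Sigma2 / K%:R)) => //; rewrite ?ltr0n ?(ltW LPhi_gt0)//.
have phi0 : Phi c (theta0 c) = mean mu (fun w => Phi c (theta c D 0 (rep w))).
  by rewrite -[LHS](mean_cst _ mu1).
rewrite phi0.
apply: (telescope_arith (Dw := fun t => Gm2 * mean mu (weight_error t))
  (phi := fun t => mean mu (fun w => Phi c (theta c D t (rep w))))
  (g := fun t => mean mu (fun w => nsq (grad_Phi_at t w))) T_gt0) => //.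
- move=> t tT; exact: (round_descent tT LPhi_gt0 etal_gt0 etag_gt0 Phi_smooth
    (fun w w0 => @safe_steps t w tT w0)
    (fun w i w0 => @het_thetas t w i tT w0) etal_le eta_le).
- by rewrite mulrC ler_wpM2r// weight_error_init.
- move=> t tT; have tT' := ltnW tT; rewrite ler_wpM2l//.
  apply: le_trans (weight_error_step tT') _; rewrite ler_wpM2l//.
  have h := mean_nsq_step_le tT' etal_gt0 (fun w w0 => @safe_steps t w tT' w0)
    (fun w i w0 => @het_thetas t w i tT' w0) etal_le.
  apply: lerD; first by rewrite ler_wpM2l// errX.
  by rewrite ler_wpM2l// mulr_ge0.
- have two0 : 0 <= 2 :> R by [].
  exact: mulr_ge0 g0 (mulr_ge0 C0 (addr_ge0 (mulr_ge0 two0 Xi0)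
    (mulr_ge0 (mulr_ge0 two0 g0) (mulr_ge0 (sqr_ge0 _) V0)))).
rewrite -[leLHS](mean_cst _ mu1); apply: mean_le => // w w0.
(* Safety of the last iterate theta^T comes from the end of the segment of round [T.-1]. *)
have T1 : (T.-1 < T)%N by rewrite prednK.
have := safe_theta_next (t := T.-1) (Dom := Dom) (fun w w0 => @safe_steps _ w T1 w0) w0.
rewrite prednK// => /Phi_lower_bound; exact.
Qed.

End Rate.
End Process.

Theorem theoremA22
  (R : realType) (X : Type) (d N m nk b T M K : nat)
  (disp : measure_display) (Om : measurableType disp) (P : probability Om R)
  (c : setup R X d N m nk b M K) (D : draws Om N nk b)
  (F : nat -> set (set Om))
  (p rho LPhi : R) (L zeta sigma : 'I_m -> R) (Dom : set 'rV[R]_d)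
  (* dimensions *)
  (N_ge2 : (2 <= N)%N) (m_ge1 : (1 <= m)%N) (nk_ge1 : (1 <= nk)%N)
  (b_ge1 : (1 <= b)%N) (T_ge1 : (1 <= T)%N)
  (K_ge1 : (1 <= K)%N)
  (M_ge1 : (1 <= M)%N)
  (p_itv : 0 < p <= 1) (M_eq : M%:R = p * N%:R)
  (* objectives *)
  (loss_diff : forall i x u, differentiable (fun v => loss c i v x) u)
  (obj_ge0 : forall k i u, 0 <= client_obj c k i u)
  (L_ge0 : forall i, 0 <= L i) (L_neq0 : exists i, L i != 0)
  (obj_smooth : forall k i u v,
     enorm (grad (client_obj c k i) u - grad (client_obj c k i) v)
       <= L i * enorm (u - v))
  (rho_gt0 : 0 < rho) (rho_le : forall i, rho <= rref c i)
  (clip_itv : 0 < rclip c <= rho)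
  (* the draws are random variables *)
  (clients_rv : forall t, (t < T)%N -> discrete_rv (clients D t))
  (reports_rv : forall t k, (t < T)%N -> discrete_rv (reports D t k))
  (batches_rv : forall t k s, (t < T)%N -> (s < K)%N ->
     discrete_rv (batches D t k s))
  (* filtration *)
  (F_sigma : forall t, (t <= T)%N -> sigma_algebra setT (F t))
  (F_sub : forall t, (t <= T)%N -> F t `<=` measurable)
  (F_step : forall t, (t < T)%N -> sigma_local D F t K `<=` F t.+1)
  (theta_adapted : forall t j, (t < T)%N ->
     measurable_wrt (F t) (fun x => theta c D t x 0 j))
  (weight_adapted : forall t i, (t < T)%N ->
     measurable_wrt (F t) (fun x => weight c D t x i))
  (* client sampling *)
  (clients_unif : forall t (A : {set 'I_N}), (t < T)%N -> #|A| = M ->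
     cond_prob_on P (F t) setT [set x | clients D t x = A] ('C(N, M)%:R^-1))
  (clients_indep : forall t (A : {set 'I_N})
     (B : 'I_N -> nat -> {ffun 'I_b -> 'I_nk}), (t < T)%N ->
     cond_indep_events P (F t) [set x | clients D t x = A]
       [set x | forall k s, (s < K)%N -> batches D t k s x = B k s])
  (* report sampling *)
  (reports_unif : forall t k (A : {set 'I_nk}), (t < T)%N ->
     #|A| = report_size c t ->
     cond_prob_on P (sigma_clients D F t) [set x | k \in clients D t x]
       [set x | reports D t k x = A] ('C(nk, report_size c t)%:R^-1))
  (fhat_ge0 : \forall x \ae P, forall t i, (t < T)%N -> 0 <= fhat c D t x i)
  (report_var_fin : forall i,
     (\big[maxe/-oo]_(t < T)
        'E_P[fun x => (N%:R^-1 * \sum_(k < N)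
               gamma c t * loss_variance c i k (theta c D t x))%R]
      < +oo)%E)
  (client_var_fin : forall i,
     (\big[maxe/-oo]_(t < T)
        'E_P[fun x => (N%:R^-1 * \sum_(k < N)
               (client_obj c k i (theta c D t x) - obj c i (theta c D t x))
                 ^+ 2)%R]
      < +oo)%E)
  (* local minibatches *)
  (batches_unif : forall t k s (B : {ffun 'I_b -> 'I_nk}),
     (t < T)%N -> (s < K)%N ->
     cond_prob_on P (sigma_local D F t s) [set x | k \in clients D t x]
       [set x | batches D t k s x = B] ((nk%:R ^+ b)^-1))
  (grad_var : forall t k s i, (t < T)%N -> (s < K)%N ->
     exists2 Y : Om -> R,
       is_cond_exp P (sigma_local D F t s)
         (fun x => let u := local_theta c D t k s x in
            enorm (batch_grad c k i u (batches D t k s x)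
                   - grad (client_obj c k i) u) ^+ 2) Y &
       \forall x \ae P, k \in clients D t x -> Y x <= sigma i ^+ 2)
  (* safe reference on the horizon *)
  (Dom_convex : convex_set (Dom : set (convex_lmodType 'rV[R]_d)))
  (theta0_safe : safe_set c Dom rho (theta0 c))
  (safe_traj : \forall x \ae P, forall t, (t < T)%N ->
     [/\ safe_set c Dom rho (theta c D t x),
         safe_set c Dom rho (theta c D t.+1 x),
         forall k s, k \in clients D t x -> (s <= K)%N ->
           safe_set c Dom rho (local_theta c D t k s x) &
         forall s, (s <= K)%N ->
           safe_set c Dom rho (virtual_theta c D t s x)])
  (safe_seg : \forall x \ae P, forall t, (t < T)%N ->
     [/\ segment (theta c D t x) (theta c D t.+1 x) `<=` safe_set c Dom rho,
         forall k s, k \in clients D t x -> (s < K)%N ->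
           segment (local_theta c D t k s x) (virtual_theta c D t s x)
             `<=` safe_set c Dom rho &
         forall s, (s < K)%N ->
           segment (virtual_theta c D t s x) (theta c D t x)
             `<=` safe_set c Dom rho])
  (* heterogeneity *)
  (het : \forall x \ae P, forall t i, (t < T)%N ->
     heterogeneity c i (theta c D t x) <= zeta i ^+ 2 /\
     forall s, (s <= K)%N ->
       heterogeneity c i (virtual_theta c D t s x) <= zeta i ^+ 2)
  (* smoothness of Phi *)
  (LPhi_gt0 : 0 < LPhi)
  (LPhi_le : LPhi <= \sum_i L i / rho
                     + \sum_i 2 * L i * rref c i / rho ^+ 2)
  (Phi_smooth : forall u v, segment u v `<=` safe_set c Dom rho ->
     enorm (grad (Phi c) u - grad (Phi c) v) <= LPhi * enorm (u - v)) :
  let Lw := \sum_i L i in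
  let cmin := \sum_i (rref c i)^-1 in
  let cmax := m%:R / rho in
  let eta_eff := etag c * etal c * K%:R in
  let Phi_lb := - \sum_i ln (rref c i) in
  let Sigma2 := \sum_i sigma i ^+ 2 in
  let zeta2 := \sum_i zeta i ^+ 2 in
  let Q := zeta2 + Sigma2 in
  let Gmax := \big[Num.max/0]_i Num.sqrt (2 * L i * rref c i) in
  let Gbar2 := 2 * (Gmax ^+ 2 + 4 * Q) in
  let HN := chi N M * zeta2 in
  let Xi := (\big[maxe/-oo]_(t < T)
               'E_P[fun x => (report_error c D t x ^+ 2)%R])%E in
  let V := 6 * Gmax ^+ 2 + 3 * (Sigma2 / K%:R) + 6 * HN
    + Lw ^+ 2 * Gbar2 / 2 * etal c ^+ 2 * (K%:R - 1) * (2 * K%:R - 1) in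
  let eta_bar := cmin ^+ 2 / (48 * cmax * LPhi) in
  let Ewt := cmax + 6 * LPhi * eta_bar in
  let C := 2 / rclip c in
  let A1 := 4 * cmax in
  let A2 := 6 * cmax * LPhi in
  let A3 := 12 * cmax * LPhi in
  let A4 := cmax * Lw ^+ 2 * Gbar2 * (cmax + LPhi * eta_bar) in
  let A5 := 8 * cmax * Ewt * Gmax ^+ 2 * C ^+ 2 in
  let A6 := 8 * cmax * Ewt * Gmax ^+ 4 * C ^+ 2 in
  let A7 := 16 * cmax * Ewt * Gmax ^+ 2 in
  let grad_sq := fun t : nat =>
    ('E_P[fun x => (enorm (grad (Phi c) (theta c D t x)) ^+ 2)%R])%E in
  let bound :=
    ((A1 * (Phi c (theta0 c) - Phi_lb) / (eta_eff * T%:R)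
      + A2 * eta_eff * Sigma2 + A3 * eta_eff * HN
      + A4 * etal c ^+ 2 * (K%:R - 1) * (2 * K%:R - 1))%:E
     + A5%:E * Xi
     + (A6 * eta_eff ^+ 2 * V + A7 / T%:R)%:E)%E in
  0 < etal c -> 0 < etag c ->
  etal c * K%:R <= 1 / (4 * Lw) ->
  etag c * etal c * K%:R <= eta_bar ->
  ((T%:R^-1)%:E * \sum_(t < T) grad_sq t <= bound)%E /\
  (\big[mine/+oo]_(t < T) grad_sq t <= bound)%E.
Proof.
move=> Lw cmin_ cmax_ eta_eff Phi_lb Sigma2 zeta2 Q Gmax_ Gbar2 HN Xi V eta_bar Ewt C.
move=> A1 A2 A3 A4 A5 A6 A7 grad_sq bound etal_gt0 etag_gt0 etal_le eta_le.
have MN : (M <= N)%N.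
  have /andP[_ p1] := p_itv.
  by rewrite -(ler_nat R) M_eq ler_piMl.
have mh := measurable_history clients_rv reports_rv batches_rv.
(* One null set for all rounds, so that a single representative per history serves throughout. *)
have good_ae : \forall x \ae P,
    (forall t, (t < T)%N ->
       segment (theta c D t x) (theta c D t.+1 x) `<=` safe_set c Dom rho) /\
    (forall t i, (t < T)%N -> heterogeneity c i (theta c D t x) <= zeta i ^+ 2).
  apply: negligibleS (negligibleU safe_seg het) => x /= nG.
  apply: contrapT => /not_orP[/notP h1 /notP h2]; apply: nG; split.
    by move=> t tT; have [] := h1 t tT.
  by move=> t i tT; have [] := h2 t i tT.
have [rep rep_good] := representative mh good_ae.
have repP w : 0 < atom_mass P (history D T) w -> history D T (rep w) = w.
  by move=> /rep_good[].
pose mu := atom_mass P (history (K := K) D T).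
have mu0 w : 0 <= mu w by exact: atom_mass_ge0.
have gradE t : (t < T)%N -> grad_sq t =
    (mean mu (fun w => nsq (grad (Phi c) (theta c D t (rep w)))))%:E.
  move=> tT; rewrite /grad_sq (expectation_atoms mh repP) => [|x y h|x]; last 2 first.
    by rewrite (theta_determined c (ltnW tT) h).
    exact: sqr_ge0.
  by congr (_%:E); apply: eq_mean => w /=; rewrite enorm_sqr.
have errE t : (t < T)%N -> ('E_P[fun x => (report_error c D t x ^+ 2)%R])%E =
    (mean mu (fun w => report_error c D t (rep w) ^+ 2))%:E.
  move=> tT; rewrite (expectation_atoms mh repP) => [//|x y h|x].
    by rewrite (report_error_determined c tT h).
  exact: sqr_ge0.
(* The maximum is over a nonempty range, as [T >= 1], and each expectation is a finite sum; hence
   [Xi] is a real number. *)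
have XiE : Xi = (fine Xi)%:E.
  rewrite fineK// fin_numE; apply/andP; split.
    rewrite gt_eqF// (lt_le_trans _ (le_bigmax _ _ (Ordinal T_ge1)))//.
    by rewrite errE// ltNyr.
  by rewrite lt_eqF//; apply/bigmax_ltP; split=> // t _; rewrite errE// ltry.
have err_le t : (t < T)%N ->
    mean mu (fun w => report_error c D t (rep w) ^+ 2) <= fine Xi.
  move=> tT; rewrite -lee_fin -XiE -errE//.
  exact: (le_bigmax _ (fun t : 'I_T => 'E_P[fun x => (report_error c D t x ^+ 2)%R])%E
            (Ordinal tT)).
have Xi0 : 0 <= fine Xi.
  by apply: le_trans (err_le 0%N T_ge1); apply: mean_ge0 => // w _; apply: sqr_ge0.
have Lw0 : 0 < Lw.
  have [i Li] := L_neq0; rewrite /Lw (bigD1 i)//= ltr_pwDl ?sumr_ge0//.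
  by rewrite lt0r Li L_ge0.
have etal_Lw : etal c * K%:R * Lw <= 4^-1.
  by rewrite -ler_pdivlMr// -invfM -[leRHS]mul1r.
have rate := gradient_rate N_ge2 m_ge1 nk_ge1 b_ge1 K_ge1 M_ge1 MN loss_diff obj_ge0
  L_ge0 obj_smooth rho_gt0 rho_le clip_itv clients_rv reports_rv batches_rv F_sigma
  theta_adapted weight_adapted clients_unif batches_unif grad_var repP LPhi_gt0
  etal_gt0 etag_gt0 Phi_smooth (fun t w tT w0 => (rep_good w w0).2.1 t tT)
  (fun t w i tT w0 => (rep_good w w0).2.2 t i tT) etal_Lw T_ge1 eta_le Xi0 err_le.
set S := \sum_(t < T) _ in rate; set r := (X in _ <= X) in rate.
have sumE : (\sum_(t < T) grad_sq t = S%:E)%E.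
  by rewrite /S -sumEFin; apply: eq_bigr => t _; rewrite gradE.
(* The closed form of [drift_bound] has denominator 6: six times it matches [A4], three times it the
   last term of [V]. *)
have boundE : bound = r%:E.
  rewrite /bound XiE -EFinM -!EFinD; congr (_%:E); rewrite /r.
  congr (_ + _ + _ + _ + _ + (_ + _)).
    rewrite /A4 /Gbar2 /Q /drift_bound -/Lw -[Gmax c L]/Gmax_ -/zeta2 -/Sigma2.
    rewrite -[cmax rho]/cmax_ -[_ / (48 * _ * _)]/eta_bar.
    by move: (cmax_) (eta_bar) (Gmax_) => y1 y2 y3; field.
  rewrite /A6 /V /Gbar2 /Q /drift_bound -/Lw -[Gmax c L]/Gmax_ -/zeta2 -/Sigma2 -/HN.
  rewrite -[cmax rho]/cmax_ -[_ / (48 * _ * _)]/eta_bar -/eta_eff -/Ewt -/C.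
  by move: (Ewt) (cmax_) (eta_eff) (C) (Gmax_) (Sigma2 / _) => y1 y2 y3 y4 y5 y6;  field.
have avg : ((T%:R^-1)%:E * \sum_(t < T) grad_sq t <= bound)%E.
  by rewrite sumE boundE -EFinM lee_fin.
split=> //; apply: le_trans avg.
rewrite sumE -EFinM.
have T0 : 0 < T%:R :> R by rewrite ltr0n.
pose gr (t : 'I_T) := mean mu (fun w => nsq (grad (Phi c) (theta c D t (rep w)))).
(* The minimum is attained at a round [t], and [T] times its value is at most the sum. *)
have [t _ tmin] := arg_minP gr (P := xpredT) (i0 := Ordinal T_ge1) isT.
apply: (@le_trans _ _ (grad_sq t)).
  exact: (bigmin_le _ t (fun s : 'I_T => grad_sq s)).
rewrite gradE// lee_fin mulrC ler_pdivlMr//.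
rewrite mulr_natr -/(gr t).
have -> : gr t *+ T = \sum_(s < T) gr t by rewrite sumr_const card_ord.
apply: ler_sum => s _.
exact: tmin.
Qed.
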